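(* Let $n,N\geq 1$ be integers, $0<\alpha<1$, and let $f=(f_1,\dots,f_N)^T:D^n\to B^N$ be holomorphic, where $D^n=\{z\in\mathbb{C}^n:\|z\|_\infty<1\}$ and $B^N=\{w\in\mathbb{C}^N:\|w\|<1\}$. Let $z_0=(z_{0,1},\dots,z_{0,n})^T\in\partial D^n$ and $1\le r\le n$ be such that $|z_{0,j}|=1$ for $1\le j\le r$ and $|z_{0,j}|<1$ for $r<j\le n$. Suppose $f$ is $C^{1+\alpha}$ at $z_0$ and $f(z_0)=w_0\in\partial B^N$. Put $a=f(0)$. Then there exist nonnegative real numbers $\gamma_1,\dots,\gamma_r$ with $\sum_{j=1}^r\gamma_j\geq 1$ such that $$\overline{J_f(z_0)}^T w_0=\lambda\,\mathrm{diag}(\gamma_1,\dots,\gamma_r,0,\dots,0)\,z_0,$$ where $\lambda=\dfrac{|1-\bar a^T w_0|^2}{1-\|a\|^2}>0$.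
   Context: Vectors are column vectors; $\|w\|$ is the Euclidean norm, $\|z\|_\infty=\max_j|z_j|$, $\bar a^T w_0=\sum_j \overline{a_j}\,w_{0,j}$. ''$f$ is $C^{1+\alpha}$ at $z_0$'' means: there is a neighborhood $V$ of $z_0$ such that $f$ extends to $\overline{D^n}\cap V$ as a $C^1$ map whose first-order partial derivatives are Hölder continuous with exponent $\alpha$ there. $J_f(z_0)=\left(\frac{\partial f_i}{\partial z_j}(z_0)\right)_{N\times n}$ is the complex Jacobian matrix of (this extension of) $f$ at $z_0$, and $\overline{J_f(z_0)}^T$ its conjugate transpose. $\mathrm{diag}(\gamma_1,\dots,\gamma_r,0,\dots,0)$ is the $n\times n$ diagonal matrix with those diagonal entries. *)

(* Defs.v *)
From mathcomp Require Import all_boot all_algebra.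
From mathcomp Require Import reals exp.
From mathcomp Require Import complex.
Set Implicit Arguments. Unset Strict Implicit. Unset Printing Implicit Defensive.
Import GRing.Theory Num.Theory.
Local Open Scope ring_scope.

Definition cabs {R : realType} (z : R[i]) : R := Normc.normc z.

Definition vnorm {R : realType} {m : nat} (v : 'cV[R[i]]_m) : R :=
  Num.sqrt (\sum_(i < m) cabs (v i 0) ^+ 2).

Definition polydisc {R : realType} {n : nat} (z : 'cV[R[i]]_n) : Prop :=
  forall j : 'I_n, cabs (z j 0) < 1.
Definition cl_polydisc {R : realType} {n : nat} (z : 'cV[R[i]]_n) : Prop :=
  forall j : 'I_n, cabs (z j 0) <= 1.

Definition unit_ball {R : realType} {N : nat} (w : 'cV[R[i]]_N) : Prop :=
  vnorm w < 1.

Definition holomorphic_on_polydisc {R : realType} {n N : nat}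
  (f : 'cV[R[i]]_n -> 'cV[R[i]]_N) : Prop :=
  forall z, polydisc z ->
  exists L : 'M[R[i]]_(N, n),
    forall e : R, 0 < e -> exists d : R, 0 < d /\
      forall h : 'cV[R[i]]_n, vnorm h < d ->
        vnorm (f (z + h) - f z - L *m h) <= e * vnorm h.

(* The real first-order differential of g at p, given the partial derivatives
   Dx j p = dg/dx_j (p), Dy j p = dg/dy_j (p)  (z_j = x_j + i y_j), applied to h. *)
Definition real_diff {R : realType} {n N : nat}
  (Dx Dy : 'I_n -> 'cV[R[i]]_n -> 'cV[R[i]]_N) (p h : 'cV[R[i]]_n) : 'cV[R[i]]_N :=
  \sum_(j < n) ('Re (h j 0) *: Dx j p + 'Im (h j 0) *: Dy j p).

(* "g is a C^1 map on the set S whose first-order partial derivatives Dx, Dy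
   are Hoelder continuous with exponent alpha on S":
   g is differentiable relative to S at every point of S with partial
   derivatives Dx j, Dy j, and these are alpha-Hoelder on S (in particular
   continuous). *)
Definition C1_holder_on {R : realType} {n N : nat} (alpha : R)
  (S : 'cV[R[i]]_n -> Prop) (g : 'cV[R[i]]_n -> 'cV[R[i]]_N)
  (Dx Dy : 'I_n -> 'cV[R[i]]_n -> 'cV[R[i]]_N) : Prop :=
  (forall p, S p ->
     forall e : R, 0 < e -> exists d : R, 0 < d /\
       forall q, S q -> vnorm (q - p) < d ->
         vnorm (g q - g p - real_diff Dx Dy p (q - p)) <= e * vnorm (q - p))
  /\ exists K : R, forall j : 'I_n, forall p q, S p -> S q ->
       vnorm (Dx j p - Dx j q) <= K * powR (vnorm (p - q)) alpha /\
       vnorm (Dy j p - Dy j q) <= K * powR (vnorm (p - q)) alpha.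

Definition C1alpha_extension_at {R : realType} {n N : nat} (alpha : R)
  (f : 'cV[R[i]]_n -> 'cV[R[i]]_N) (z0 : 'cV[R[i]]_n) (rho : R)
  (g : 'cV[R[i]]_n -> 'cV[R[i]]_N)
  (Dx Dy : 'I_n -> 'cV[R[i]]_n -> 'cV[R[i]]_N) : Prop :=
  0 < rho /\
  (forall z, polydisc z -> vnorm (z - z0) < rho -> g z = f z) /\
  C1_holder_on alpha (fun z => cl_polydisc z /\ vnorm (z - z0) < rho) g Dx Dy.

Definition cjacobian {R : realType} {n N : nat}
  (Dx Dy : 'I_n -> 'cV[R[i]]_n -> 'cV[R[i]]_N) (p : 'cV[R[i]]_n) : 'M[R[i]]_(N, n) :=
  \matrix_(i < N, j < n) ((Dx j p i 0 - 'i * Dy j p i 0) / 2%:R).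

Definition adjoint {R : realType} {m k : nat} (A : 'M[R[i]]_(m, k)) : 'M[R[i]]_(k, m) :=
  (map_mx Num.conj A)^T.

(* Main.v *)
Require Import Defs.
From mathcomp Require Import all_boot all_order all_algebra.
From mathcomp Require Import all_classical all_reals all_analysis.
From mathcomp Require Import complex.
From mathcomp Require Import ring lra.
Set Implicit Arguments. Unset Strict Implicit. Unset Printing Implicit Defensive.
Import Order.TTheory GRing.Theory Num.Theory.
Import numFieldNormedType.Exports.
Local Open Scope classical_set_scope.
Local Open Scope ring_scope.
Local Notation Re := complex.Re.
Local Notation Im := complex.Im.

(** Write <w, v> for the Hermitian product, a = f(0), and
    h(w) = 1 - (1 - |a|^2) (1 - <w, w0>) / ((1 - <w, a>) (1 - <a, w0>)), which is the
    product of the images of w and w0 under the ball automorphism exchanging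
    a and 0; hence |h| <= 1 on the ball.  The Schwarz lemma applied to
    zeta |-> h(f(zeta z0)) gives |h(f(t z0))| <= t, and differentiating at t = 1 gives
    Re <J z0, w0> >= lambda.  On the other hand Re <f, w0> <= 1 attains its maximum
    at z0, so Re <J v, w0> <= 0 for every direction v pointing into the polydisc;
    testing v on the coordinate axes shows that z0_j <J e_j, w0> is real and nonnegative
    for j <= r and that <J e_j, w0> = 0 for j > r.

    Holomorphy only means pointwise complex differentiability, so the Schwarz lemma
    rests on Goursat's bisection argument, carried out for real 1-forms that are
    closed at every point.  In logarithmic polar coordinates it gives the mean value
    property, which forbids an interior maximum of |G|^2 + eps |z|^2 where
    G(z) = H(z) / z. *)

(** * Goursat theorem for real 1-forms *)

Section RealAnalysis.
Variable R : realType.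
Implicit Types (x y a b c d e : R).

(** Precomposing [u] with the projection [cl] onto [[a, b]] gives a function continuous on the whole
    line. Integrating it from [a - 1] makes every point of [[a, b]] interior, so the derivative is
    two-sided at the endpoints as well. *)
Lemma primitive_exists (u : R -> R) a b : a <= b ->
  (forall x, a <= x <= b -> {for x, continuous u}) ->
  exists U : R -> R, forall x, a <= x <= b -> is_derive x 1 U (u x).
Proof.
move=> ab cu; pose cl x := Num.max a (Num.min b x).
have clab x : a <= cl x <= b.
  by rewrite /cl le_max lexx /= ge_max ab ge_min lexx.
have clid x : a <= x <= b -> cl x = x.
  by move=> /andP[ax xb]; rewrite /cl (min_r xb) (max_r ax).
have cl1 x y : `|cl x - cl y| <= `|x - y|.
  rewrite /cl ler_norml; have := ler_norm (x - y); have := ler_norm (- (x - y)).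
  rewrite normrN; case: (leP b x) => ?; case: (leP b y) => ?;
    do 2?[case: (leP a _) => ?]; lra.
have ccl : continuous (u \o cl).
  move=> x; apply: continuous_comp; last exact: cu.
  apply/cvgrPdist_lt => e e0; near=> y; apply: le_lt_trans (cl1 _ _) _.
  by near: y; apply: cvgr_dist_lt e0; exact: cvg_id.
pose mu := @lebesgue_measure R.
have iu : mu.-integrable `[a - 1, b + 1] (EFin \o (u \o cl)).
  apply: continuous_compact_integrable; first exact: segment_compact.
  exact: continuous_subspaceT.
exists (fun x => (\int[mu]_(t in `[(a - 1)%R, x]) (u \o cl) t)%R) => x /andP[ax xb].
have xu : x < b + 1 by lra.
have xl : a - 1 < x by lra.
have [D1 D2] := continuous_FTC1_closed xu iu xl (ccl x).
apply: DeriveDef => //.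
by rewrite -derive1E D2 /= clid ?ax.
Unshelve. all: by end_near. Qed.

Lemma is_derive_mull (k x : R) : is_derive x 1 (fun t => k * t) k.
Proof.
have D : is_derive x 1 (k \*: (@id R)) (k *: 1) by exact: is_deriveZ.
by move: D; rewrite /GRing.scale /= mulr1.
Qed.

Lemma mvt_le (g dg : R -> R) a b M : a <= b ->
  (forall x, a <= x <= b -> is_derive x 1 g (dg x)) ->
  (forall x, a <= x <= b -> dg x <= M) -> g b - g a <= M * (b - a).
Proof.
move=> ab Hd HM.
have [|||x xab ->] := @MVT_segment R g dg a b => //.
- by move=> x; rewrite in_itv /= => /andP[ax xb]; apply: Hd; rewrite !ltW.
- apply: derivable_within_continuous => x; rewrite in_itv /= => xab.
  by have := Hd x xab; case.
- by apply: ler_wpM2r; [rewrite subr_ge0|apply: HM; rewrite in_itv /= in xab].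
Qed.

Lemma mvt_norm_le (g dg : R -> R) a b M : a <= b ->
  (forall x, a <= x <= b -> is_derive x 1 g (dg x)) ->
  (forall x, a <= x <= b -> `|dg x| <= M) -> `|g b - g a| <= M * (b - a).
Proof.
move=> ab Hd HM; rewrite ler_norml; apply/andP; split; last first.
  by apply: mvt_le => // x /HM; rewrite ler_norml => /andP[].
rewrite lerNl opprB.
have := @mvt_le (- g) (- dg) a b M ab; rewrite !fctE opprK addrC; apply.
  by move=> x xab; apply: is_deriveN; exact: Hd.
by move=> x /HM; rewrite ler_norml => /andP[]; rewrite lerNl.
Qed.

Lemma nested_intervals (l u : nat -> R) :
  (forall k, l k <= l k.+1) -> (forall k, u k.+1 <= u k) ->
  (forall k, l k <= u k) -> exists x, forall k, l k <= x <= u k.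
Proof.
move=> Hl Hu Hlu.
have ml : {homo l : i j / (i <= j)%N >-> i <= j}.
  by apply: homo_leq => // x y z; exact: le_trans.
have mu : {homo u : i j / (i <= j)%N >-> j <= i}.
  by apply: homo_leq => // x y z h1 h2; exact: le_trans h2 h1.
have lu i j : l i <= u j.
  have [ij|ji] := leqP i j; first exact: le_trans (ml _ _ ij) (Hlu j).
  by apply: le_trans (Hlu i) _; apply: mu; exact: ltnW.
exists (sup (range l)) => k; apply/andP; split.
  apply: ub_le_sup; last by exists k.
  by exists (u 0%N) => _ [i _ <-].
apply: ge_sup; first by exists (l 0%N), 0%N.
by move=> _ [i _ <-].
Qed.

(** Total differentiability at a single point, with partial derivatives [A] and [B] and the error
    measured in the l1 norm; nothing is asked of the partial derivatives at other points. *)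
Definition diff2 (P : R -> R -> R) x y A B :=
  forall e, 0 < e -> exists d, 0 < d /\ forall h k, `|h| < d -> `|k| < d ->
    `|P (x + h) (y + k) - P x y - (A * h + B * k)| <= e * (`|h| + `|k|).

Section Goursat.
Variables (P Q cP cQ : R -> R -> R) (a b c d : R).
Hypothesis HP : forall x y, a <= x <= b -> c <= y <= d ->
  is_derive x 1 (fun x => cP x y) (P x y).
Hypothesis HQ : forall x y, a <= x <= b -> c <= y <= d ->
  is_derive y 1 (fun y => cQ x y) (Q x y).
Hypothesis closedPQ : forall x y, a <= x <= b -> c <= y <= d ->
  exists A B C, diff2 P x y A B /\ diff2 Q x y B C.

(* The integral of P dx + Q dy along the boundary of a rectangle, up to sign *)
Let phi a b c d := (cP b d - cP a d - cP b c + cP a c)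
                 - (cQ b d - cQ b c - cQ a d + cQ a c).

(** The coefficient [B] shared by the two expansions in [closedPQ] says that dP/dy = dQ/dx at the
    point. The linear parts of [P] and [Q] therefore both contribute [B * w * h], with opposite
    signs, and only the remainders, of size e times the half-perimeter, are left. *)
Lemma circulation_small x0 y0 e : a <= x0 <= b -> c <= y0 <= d -> 0 < e ->
  exists2 r, 0 < r & forall a' b' c' d', a <= a' -> b' <= b -> c <= c' -> d' <= d ->
  a' <= x0 <= b' -> c' <= y0 <= d' -> (b' - a') + (d' - c') < r ->
  `|phi a' b' c' d'| <= 2 * e * ((b' - a') + (d' - c')) ^+ 2.
Proof.
move=> x0ab y0cd e0.
have [A [B [C [dP dQ]]]] := closedPQ x0ab y0cd.
have [r1 [r10 {}dP]] := dP e e0.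
have [r2 [r20 {}dQ]] := dQ e e0.
exists (Num.min r1 r2); first by rewrite lt_min r10.
move=> a' b' c' d' aa bb cc dd /andP[ax xb] /andP[cy yd]; rewrite lt_min => /andP[w1 w2].
set w := b' - a' in w1 w2 *; set h := d' - c' in w1 w2 *.
have w0 : 0 <= w by rewrite /w; lra.
have h0 : 0 <= h by rewrite /h; lra.
have EP x y : a' <= x <= b' -> c' <= y <= d' ->
    `|P x y - P x0 y0 - (A * (x - x0) + B * (y - y0))| <= e * (w + h).
  move=> /andP[x1 x2] /andP[y1 y2].
  have xw : `|x - x0| <= w by rewrite ler_norml /w; lra.
  have yh : `|y - y0| <= h by rewrite ler_norml /h; lra.
  have := dP (x - x0) (y - y0); rewrite !subrKC => D.
  apply: le_trans (D _ _) _; [lra|lra|].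
  by apply: ler_wpM2l; [exact: ltW|lra].
have EQ x y : a' <= x <= b' -> c' <= y <= d' ->
    `|Q x y - Q x0 y0 - (B * (x - x0) + C * (y - y0))| <= e * (w + h).
  move=> /andP[x1 x2] /andP[y1 y2].
  have xw : `|x - x0| <= w by rewrite ler_norml /w; lra.
  have yh : `|y - y0| <= h by rewrite ler_norml /h; lra.
  have := dQ (x - x0) (y - y0); rewrite !subrKC => D.
  apply: le_trans (D _ _) _; [lra|lra|].
  by apply: ler_wpM2l; [exact: ltW|lra].
(* The mean value inequality replaces integration over x: the derivative P(x, d') - P(x, c') differs
   from [B * h] by at most [2 * e * (w + h)]. [IQ] is the same with the coordinates exchanged. *)
have IP : `|(cP b' d' - cP b' c' - B * h * b') - (cP a' d' - cP a' c' - B * h * a')|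
    <= (2 * e * (w + h)) * w.
  apply: (@mvt_norm_le (fun x => cP x d' - cP x c' - B * h * x)
     (fun x => P x d' - P x c' - B * h)); first lra.
    move=> x /andP[x1 x2].
    have D1 : is_derive x 1 (fun x => cP x d') (P x d') by apply: HP; lra.
    have D2 : is_derive x 1 (fun x => cP x c') (P x c') by apply: HP; lra.
    have D3 : is_derive x 1 (fun x => B * h * x) (B * h).
      exact: is_derive_mull.
    by apply: is_deriveB.
  move=> x xab; have := EP x d' xab; have := EP x c' xab.
  have -> : c' <= c' <= d' by lra.
  have -> : c' <= d' <= d' by lra.
  move=> /(_ isT) + /(_ isT); rewrite !ler_norml /h.
  by move=> /andP[? ?] /andP[? ?]; apply/andP; split; lra.
have IQ : `|(cQ b' d' - cQ a' d' - B * w * d') - (cQ b' c' - cQ a' c' - B * w * c')|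
    <= (2 * e * (w + h)) * h.
  apply: (@mvt_norm_le (fun y => cQ b' y - cQ a' y - B * w * y)
     (fun y => Q b' y - Q a' y - B * w)); first lra.
    move=> y /andP[y1 y2].
    have D1 : is_derive y 1 (fun y => cQ b' y) (Q b' y) by apply: HQ; lra.
    have D2 : is_derive y 1 (fun y => cQ a' y) (Q a' y) by apply: HQ; lra.
    have D3 : is_derive y 1 (fun x => B * w * x) (B * w).
      exact: is_derive_mull.
    by apply: is_deriveB.
  move=> y ycd; have := EQ a' y; have := EQ b' y.
  have -> : a' <= a' <= b' by lra.
  have -> : a' <= b' <= b' by lra.
  move=> /(_ isT ycd) + /(_ isT ycd); rewrite !ler_norml /w.
  by move=> /andP[? ?] /andP[? ?]; apply/andP; split; lra.
have -> : phi a' b' c' d' =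
   ((cP b' d' - cP b' c' - B * h * b') - (cP a' d' - cP a' c' - B * h * a'))
 - ((cQ b' d' - cQ a' d' - B * w * d') - (cQ b' c' - cQ a' c' - B * w * c')).
  by rewrite /phi /w /h; ring.
apply: le_trans (ler_normB _ _) _.
apply: le_trans (lerD IP IQ) _.
by rewrite le_eqVlt; apply/orP; left; apply/eqP; ring.
Qed.

(** Circulation is additive over the four quarters of a rectangle, so some quarter carries at least
    a fourth of it. Iterating gives nested rectangles that shrink to a point, where
    [circulation_small] bounds the circulation by an arbitrarily small multiple of the squared
    size. *)
Theorem goursat_rectangle : a <= b -> c <= d -> phi a b c d = 0.
Proof.
move=> ab cd; pose W k := (b - a) / 2 ^+ k; pose H k := (d - c) / 2 ^+ k.
have p2 k : 0 < (2 : R) ^+ k by rewrite exprn_gt0.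
have W0 k : 0 <= W k by rewrite divr_ge0 ?subr_ge0 // ltW.
have H0 k : 0 <= H k by rewrite divr_ge0 ?subr_ge0 // ltW.
have WS k : W k = W k.+1 + W k.+1.
  by rewrite /W exprS; field; rewrite (gt_eqF (p2 k)).
have HS k : H k = H k.+1 + H k.+1.
  by rewrite /H exprS; field; rewrite (gt_eqF (p2 k)).
pose f k (p : R * R) := phi p.1 (p.1 + W k) p.2 (p.2 + H k).
pose ok k p q := `|f k p| / 4 <= `|f k.+1 q|.
(* [p] is the lower left corner of the current rectangle. The fourth quarter is the default: if the
   other three fail the test, the triangle inequality forces it to pass. *)
pose next k (p : R * R) :=
  if ok k p p then p else
  if ok k p (p.1 + W k.+1, p.2) then (p.1 + W k.+1, p.2) else
  if ok k p (p.1, p.2 + H k.+1) then (p.1, p.2 + H k.+1) else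
  (p.1 + W k.+1, p.2 + H k.+1).
have nextP k p : [/\ ok k p (next k p), p.1 <= (next k p).1 <= p.1 + W k.+1 &
    p.2 <= (next k p).2 <= p.2 + H k.+1].
  have W1 := W0 k.+1; have H1 := H0 k.+1.
  rewrite /next; case: ifPn => [?|o1]; first by split=> //; lra.
  case: ifPn => [?|o2]; first by split=> //=; lra.
  case: ifPn => [?|o3]; first by split=> //=; lra.
  split=> /=; [|lra|lra].
  move: o1 o2 o3; rewrite /ok -!ltNge.
  set g0 := f k.+1 p; set g1 := f k.+1 _; set g2 := f k.+1 _; set g3 := f k.+1 _.
  have -> : f k p = g0 + g1 + g2 + g3.
    by rewrite /g0 /g1 /g2 /g3 /f /= WS HS !addrA /phi; ring.
  have := ler_normD (g0 + g1 + g2) g3; have := ler_normD (g0 + g1) g2.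
  have := ler_normD g0 g1; lra.
pose s := fix s k := if k is k'.+1 then next k' (s k') else (a, c).
have [x0 x0P] : exists x, forall k, (s k).1 <= x <= (s k).1 + W k.
  apply: nested_intervals => k; last by rewrite lerDl.
    by case: (nextP k (s k)) => _ /andP[].
  by case: (nextP k (s k)) => _ /andP[_ ?] _; rewrite (WS k) -[s k.+1]/(next k (s k)); lra.
have [y0 y0P] : exists x, forall k, (s k).2 <= x <= (s k).2 + H k.
  apply: nested_intervals => k; last by rewrite lerDl.
    by case: (nextP k (s k)) => _ _ /andP[].
  by case: (nextP k (s k)) => _ _ /andP[_ ?]; rewrite (HS k) -[s k.+1]/(next k (s k)); lra.
have inv k : [/\ a <= (s k).1, (s k).1 + W k <= b, c <= (s k).2 & (s k).2 + H k <= d].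
  elim: k => [|k [i1 i2 i3 i4]]; first by rewrite /W /H !expr0 !divr1 /=; split; lra.
  by case: (nextP k (s k)) => _ /andP[? ?] /andP[? ?]; move: i2 i4;
    rewrite (WS k) (HS k) -[s k.+1]/(next k (s k)) => i2 i4; split; lra.
have big k : `|f 0%N (a, c)| / 4 ^+ k <= `|f k (s k)|.
  elim: k => [|k IH]; first by rewrite expr0 divr1.
  case: (nextP k (s k)) => + _ _; rewrite /ok => o; apply: le_trans o.
  by rewrite exprSr invfM mulrA ler_pM2r // invr_gt0.
have f0E : f 0%N (a, c) = phi a b c d.
  by rewrite /f /W /H !expr0 !divr1 /= !subrKC.
(* After k bisections the circulation is at least [4 ^- k] times the initial one, and the squared
   half-perimeter has shrunk by exactly the same factor, so the powers of 4 cancel. *)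
have small e : 0 < e -> `|phi a b c d| <= e * (2 * (b - a + (d - c)) ^+ 2).
  move=> e0.
  have x0ab : a <= x0 <= b.
    by have := x0P 0%N; rewrite /W expr0 divr1 /=; lra.
  have y0cd : c <= y0 <= d.
    by have := y0P 0%N; rewrite /H expr0 divr1 /=; lra.
  have [r r0 loc] := circulation_small x0ab y0cd e0.
  have [k hk] : exists k, (b - a + (d - c)) / 2 ^+ k < r.
    exists (Num.bound ((b - a + (d - c)) / r)).
    set m := Num.bound _.
    rewrite ltr_pdivrMr // mulrC -ltr_pdivrMr //.
    have h1 : (b - a + (d - c)) / r < m%:R.
      apply: archi_boundP; apply: divr_ge0; last exact: ltW.
      by rewrite addr_ge0 ?subr_ge0.
    apply: lt_le_trans h1 _.
    by rewrite -natrX ler_nat ltnW // ltn_expl.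
  have [i1 i2 i3 i4] := inv k.
  have := loc _ _ _ _ i1 i2 i3 i4 (x0P k) (y0P k).
  rewrite (addrC (s k).1) (addrC (s k).2) !addrK (addrC _ (s k).1) (addrC _ (s k).2) -/(f k (s k)) => /(_ _) B1.
  have B : `|f k (s k)| <= 2 * e * (W k + H k) ^+ 2.
    by apply: B1; rewrite -mulrDl.
  have := le_trans (big k) B; rewrite f0E -mulrDl expr_div_n ler_pdivrMr ?exprn_gt0 //.
  rewrite -exprM mulnC exprM; have -> : (2 : R) ^+ 2 = 4 by ring.
  rewrite -!mulrA mulVf; first by move=> h; apply: le_trans h _; rewrite le_eqVlt; apply/orP; left; apply/eqP; ring.
  by rewrite expf_neq0.
apply/eqP; rewrite -normr_le0; apply/ler_addgt0Pl => e e0; rewrite addr0.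
set K := 2 * (b - a + (d - c)) ^+ 2 in small.
have K0 : 0 <= K by rewrite mulr_ge0 // sqr_ge0.
(* The [+ 1] covers a rectangle reduced to a point, where [K] is 0. *)
apply: le_trans (small (e / (K + 1)) _) _; first by rewrite divr_gt0 //; lra.
by rewrite mulrAC ler_pdivrMr; [nra|lra].
Qed.

End Goursat.
End RealAnalysis.

(** * Mean value property *)

Section ComplexModulus.
Variable R : realType.
Implicit Types (z w : R[i]) (x y e d : R).

Lemma RecD z w : Re (z + w) = Re z + Re w. Proof. by case: z w => ? ? [? ?]. Qed.
Lemma ImcD z w : Im (z + w) = Im z + Im w. Proof. by case: z w => ? ? [? ?]. Qed.
Lemma RecN z : Re (- z) = - Re z. Proof. by case: z. Qed.
Lemma ImcN z : Im (- z) = - Im z. Proof. by case: z. Qed.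
Lemma RecM z w : Re (z * w) = Re z * Re w - Im z * Im w.
Proof. by case: z w => ? ? [? ?]. Qed.
Lemma ImcM z w : Im (z * w) = Re z * Im w + Im z * Re w.
Proof. by case: z w => ? ? [? ?]. Qed.

Lemma cabsE z : cabs z = Num.sqrt (Re z ^+ 2 + Im z ^+ 2). Proof. by case: z. Qed.
Lemma cabs_ge0 z : 0 <= cabs z. Proof. by rewrite cabsE sqrtr_ge0. Qed.
Lemma cabs_sqr z : cabs z ^+ 2 = Re z ^+ 2 + Im z ^+ 2.
Proof. by rewrite cabsE sqr_sqrtr // addr_ge0 // sqr_ge0. Qed.
Lemma cabsM z w : cabs (z * w) = cabs z * cabs w. Proof. exact: Normc.normcM. Qed.
Lemma cabsV z : cabs z^-1 = (cabs z)^-1. Proof. exact: Normc.normcV. Qed.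
Lemma cabs0 : cabs (0 : R[i]) = 0. Proof. exact: Normc.normc0. Qed.
Lemma cabs1 : cabs (1 : R[i]) = 1. Proof. exact: Normc.normc1. Qed.
Lemma cabsN z : cabs (- z) = cabs z. Proof. exact: normcN. Qed.
Lemma cabsD z w : cabs (z + w) <= cabs z + cabs w. Proof. exact: le_normcD. Qed.
Lemma cabsB z w : cabs (z - w) <= cabs z + cabs w.
Proof. by rewrite -(cabsN w) cabsD. Qed.
Lemma cabs_eq0 z : (cabs z == 0) = (z == 0).
Proof.
by apply/eqP/eqP => [|->]; [exact: Normc.eq0_normc|exact: cabs0].
Qed.
Lemma cabs_gt0 z : (0 < cabs z) = (z != 0).
Proof. by rewrite lt_def cabs_ge0 andbT cabs_eq0. Qed.
Lemma cabs_real x : cabs (x%:C)%C = `|x|.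
Proof. by rewrite cabsE /= expr0n /= addr0 sqrtr_sqr. Qed.
Lemma cabs_conj z : cabs (conjc z) = cabs z.
Proof. by case: z => x y; rewrite !cabsE /= sqrrN. Qed.

Lemma le_cabs z x : 0 <= x -> (cabs z <= x) = (Re z ^+ 2 + Im z ^+ 2 <= x ^+ 2).
Proof. by move=> x0; rewrite -cabs_sqr ler_pXn2r // nnegrE // cabs_ge0. Qed.

Lemma Re_le_cabs z : `|Re z| <= cabs z.
Proof. by rewrite cabsE -sqrtr_sqr ler_wsqrtr // lerDl sqr_ge0. Qed.
Lemma Im_le_cabs z : `|Im z| <= cabs z.
Proof. by rewrite cabsE -sqrtr_sqr ler_wsqrtr // lerDr sqr_ge0. Qed.
Lemma cabs_le_ReIm z : cabs z <= `|Re z| + `|Im z|.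
Proof.
rewrite le_cabs ?addr_ge0 // -(real_normK (num_real (Re z))) -(real_normK (num_real (Im z))).
by have := normr_ge0 (Re z); have := normr_ge0 (Im z); nra.
Qed.

End ComplexModulus.

(** * Logarithmic polar coordinates and circle averages *)

Section MeanValue.
Variable R : realType.
Implicit Types (z w p : R[i]) (x y e d s t : R).

Definition cdiff (f : R[i] -> R[i]) z l :=
  forall e, 0 < e -> exists d, 0 < d /\ forall h, cabs h < d ->
    cabs (f (z + h) - f z - l * h) <= e * cabs h.

Definition ccont (f : R[i] -> R[i]) z :=
  forall e, 0 < e -> exists d, 0 < d /\ forall h, cabs h < d ->
    cabs (f (z + h) - f z) <= e.

Lemma is_derive_eps (f : R -> R) x l e : is_derive x 1 f l -> 0 < e ->
  exists d, 0 < d /\ forall h, `|h| < d -> `|f (x + h) - f x - l * h| <= e * `|h|.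
Proof.
case=> df <- e0.
have /cvgrPdist_le /(_ e e0) := df.
rewrite /= near_withinE => /nbhs_ballP[d /= d0 H].
exists d; split=> // h hd.
have [->|h0] := eqVneq h 0; first by rewrite addr0 mulr0 subrr subr0 normr0 mulr0.
have := H h; rewrite /ball /= sub0r normrN => /(_ hd h0).
rewrite (mulrC e).
have -> : h%:A = h by exact: mulr1.
rewrite (addrC h x) -/('D_1 f x) => A.
have -> : f (x + h) - f x - 'D_1 f x * h =
   - (h * ('D_1 f x - h^-1 * (f (x + h) - f x))).
  by rewrite mulrBr mulrA mulfV // mul1r opprB mulrC (mulrC h).
by rewrite normrN normrM ler_wpM2l.
Qed.

(** The exponential of s + it. With the logarithm of the radius as first coordinate the change of
    variables is holomorphic, an annulus becomes a rectangle and its circles become the sides with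
    [s] constant. *)
Definition cpolar s t : R[i] := ((expR s * cos t) +i* (expR s * sin t))%C.

Lemma cpolarD s t s' t' : cpolar (s + s') (t + t') = cpolar s t * cpolar s' t'.
Proof.
rewrite /cpolar expRD cosD sinD; apply/eqP; rewrite eq_complex /=.
by apply/andP; split; apply/eqP; ring.
Qed.

Lemma cabs_cpolar s t : cabs (cpolar s t) = expR s.
Proof.
rewrite cabsE /= !exprMn -mulrDr cos2Dsin2 mulr1 sqrtr_sqr ger0_norm //.
Qed.

(** The exponential has derivative 1 at 0, obtained from the real derivatives of [expR], [cos] and
    [sin]; by [cpolarD] this settles every other point. *)
Lemma cpolar_diff0 e : 0 < e -> exists d, 0 < d /\ forall h k, `|h| < d -> `|k| < d ->
  cabs (cpolar h k - 1 - (h +i* k)%C) <= e * (`|h| + `|k|).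
Proof.
move=> e0; have e1 : 0 < e / 8 by rewrite divr_gt0.
have [d1 [d10 H1]] := is_derive_eps (is_derive_expR (0 : R)) e1.
have [d2 [d20 H2]] := is_derive_eps (is_derive_cos (0 : R)) e1.
have [d3 [d30 H3]] := is_derive_eps (is_derive_sin (0 : R)) e1.
have [d4 [d40 H4]] := is_derive_eps (is_derive_expR (0 : R)) (ltr01 : 0 < 1 :> R).
pose d := Num.min (Num.min d1 d2) (Num.min (Num.min d3 d4) (Num.min (e / 8) (1 / 2))).
exists d; split; first by rewrite /d !lt_min d10 d20 d30 d40 e1 /=; lra.
move=> h k; rewrite /d !lt_min.
move=> /andP[/andP[h1 h2] /andP[/andP[h3 h4] /andP[h5 h6]]].
move=> /andP[/andP[k1 k2] /andP[/andP[k3 k4] /andP[k5 k6]]].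
move: (H1 h h1) (H2 k k2) (H3 k k3) (H4 h h4).
rewrite !add0r expR0 cos0 sin0 oppr0 mul0r !mul1r !subr0 addr0 => A1 A2 A3 A4.
set X := expR h in A1 A4 *.
have A5 : `|X - 1| <= 2 * `|h|.
  have := ler_normD (X - 1 - h) h; rewrite subrK; lra.
have X0 : 0 <= X by exact: expR_ge0.
have X2 : X <= 2 by have := ler_norm (X - 1); lra.
apply: le_trans (cabs_le_ReIm _) _; rewrite !RecD !ImcD !RecN !ImcN /= -/X oppr0 addr0.
have -> : X * cos k - 1 - h = (X - 1 - h) + X * (cos k - 1) by ring.
have -> : X * sin k - k = X * (sin k - k) + (X - 1) * k by ring.
have B1 : `|X * (cos k - 1)| <= 2 * (e / 8 * `|k|).
  by rewrite normrM ger0_norm //; apply: ler_pM.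
have B2 : `|X * (sin k - k)| <= 2 * (e / 8 * `|k|).
  by rewrite normrM ger0_norm //; apply: ler_pM.
have B3 : `|(X - 1) * k| <= (2 * (e / 8)) * `|k|.
  rewrite normrM ler_wpM2r //; apply: le_trans A5 _; lra.
apply: le_trans (lerD (ler_normD _ _) (ler_normD _ _)) _.
have := normr_ge0 h; have := normr_ge0 k; nra.
Qed.

(** Chain rule: in the variable s + it, the function f(p + e^(s + it)) has the complex derivative
    [l * cpolar s t]. *)
Lemma cpolar_comp_diff (f : R[i] -> R[i]) p s t l e : 0 < e ->
  cdiff f (p + cpolar s t) l ->
  exists d, 0 < d /\ forall h k, `|h| < d -> `|k| < d ->
  cabs (f (p + cpolar (s + h) (t + k)) - f (p + cpolar s t)
        - (l * cpolar s t) * (h +i* k)%C) <= e * (`|h| + `|k|).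
Proof.
move=> e0 df; set E := cpolar s t; set M := cabs E.
have M0 : 0 < M by rewrite /M cabs_cpolar expR_gt0.
set L := cabs l; have L0 : 0 <= L by exact: cabs_ge0.
have e1 : 0 < e / (4 * M) by rewrite divr_gt0 // mulr_gt0.
have [d1 [d10 H1]] := df _ e1.
have e2 : 0 < e / (2 * (M * (L + 1))) by rewrite divr_gt0 // !mulr_gt0 //; lra.
have [d2 [d20 H2]] := cpolar_diff0 e2.
have [d3 [d30 H3]] := cpolar_diff0 (ltr01 : 0 < 1 :> R).
pose d := Num.min (d1 / (4 * M)) (Num.min d2 d3).
exists d; split; first by rewrite /d !lt_min d20 d30 divr_gt0 // mulr_gt0.
move=> h k; rewrite /d !lt_min => /andP[h1 /andP[h2 h3]] /andP[k1 /andP[k2 k3]].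
have -> : cpolar (s + h) (t + k) = E * cpolar h k by rewrite cpolarD.
set D := E * (cpolar h k - 1).
have -> : p + E * cpolar h k = p + E + D by rewrite /D; ring.
set S := `|h| + `|k|; have S0 : 0 <= S by rewrite addr_ge0.
have hk : cabs (h +i* k)%C <= S by exact: le_trans (cabs_le_ReIm _) _.
have D1 : cabs D <= M * (2 * S).
  rewrite /D cabsM ler_wpM2l //; first exact: ltW.
  have := cabsD (cpolar h k - 1 - (h +i* k)%C) (h +i* k)%C; rewrite subrK.
  have := H3 h k h3 k3; rewrite -/S; lra.
have -> : f (p + E + D) - f (p + E) - l * E * (h +i* k)%C =
   (f (p + E + D) - f (p + E) - l * D) + l * (E * (cpolar h k - 1 - (h +i* k)%C)).
  by rewrite /D; ring.
apply: le_trans (cabsD _ _) _.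
have T1 : cabs (f (p + E + D) - f (p + E) - l * D) <= e / 2 * S.
  apply: le_trans (H1 _ _) _.
    apply: le_lt_trans D1 _.
    have : S < d1 / (2 * M).
      have -> : d1 / (2 * M) = d1 / (4 * M) + d1 / (4 * M) by field; rewrite gt_eqF.
      by rewrite ltrD.
    rewrite ltr_pdivlMr ?mulr_gt0 //; lra.
  apply: le_trans (ler_wpM2l (ltW e1) D1) _.
  by rewrite le_eqVlt; apply/orP; left; apply/eqP; field; rewrite gt_eqF.
have T2 : cabs (l * (E * (cpolar h k - 1 - (h +i* k)%C))) <= e / 2 * S.
  rewrite !cabsM -/L -/M.
  apply: le_trans (ler_wpM2l L0 (ler_wpM2l (ltW M0) (H2 h k h2 k2))) _.
  rewrite -/S.
  have -> : L * (M * (e / (2 * (M * (L + 1))) * S)) = (L / (L + 1)) * (e / 2 * S).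
    by field; rewrite (gt_eqF M0) /= gt_eqF //; lra.
  rewrite ler_piMl //; first by rewrite mulr_ge0 //; lra.
  by rewrite ler_pdivrMr; lra.
lra.
Qed.

(** With F(s, t) = f(p + e^(s + it)), the form Im F ds + Re F dt is the imaginary part of F d(s +
    it). It is closed because both expansions share the coefficient [Re m], which is the
    Cauchy-Riemann relation needed by [goursat_rectangle]. *)
Lemma polar_CauchyRiemann (f : R[i] -> R[i]) p s t l :
  cdiff f (p + cpolar s t) l ->
  let m := l * cpolar s t in
  diff2 (fun s t => Im (f (p + cpolar s t))) s t (Im m) (Re m) /\
  diff2 (fun s t => Re (f (p + cpolar s t))) s t (Re m) (- Im m).
Proof.
move=> df m; split=> e e0; have [d [d0 H]] := cpolar_comp_diff e0 df;
  exists d; split=> // h k hd kd; apply: le_trans (H h k hd kd).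
- apply: le_trans (Im_le_cabs _).
  by rewrite /m !(ImcD, ImcN, ImcM) /= le_eqVlt; apply/orP; left; apply/eqP; congr `| _ |; ring.
- apply: le_trans (Re_le_cabs _).
  by rewrite /m !(RecD, RecN, RecM, ImcM) /= le_eqVlt; apply/orP; left; apply/eqP; congr `| _ |; ring.
Qed.

Lemma diff2_continuous (P : R -> R -> R) x y A B : diff2 P x y A B ->
  {for x, continuous (fun x => P x y)} /\ {for y, continuous (P x)}.
Proof.
move=> dP; have [d [d0 H]] := dP 1 ltr01.
have K (g : R -> R) (z a : R) : (forall h : R, `|h| < d -> `|g (z + h) - g z - a * h| <= `|h|) ->
    {for z, continuous g}.
  move=> Hg; apply/cvgrPdist_le => e e0.
  have e1 : 0 < e / (1 + `|a|) by rewrite divr_gt0 // ltr_pwDl.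
  near=> u.
  have ud : `|u - z| < d.
    by rewrite distrC; near: u; apply: cvgr_dist_lt d0; exact: cvg_id.
  have ue : `|u - z| < e / (1 + `|a|).
    by rewrite distrC; near: u; apply: cvgr_dist_lt e1; exact: cvg_id.
  have := Hg _ ud; rewrite (addrC z) subrK => Hu.
  rewrite distrC; move: ue; rewrite ltr_pdivlMr ?ltr_pwDl // => ue.
  have := ler_normD (g u - g z - a * (u - z)) (a * (u - z)); rewrite subrK normrM; lra.
split.
  apply: (@K _ _ A) => h hd; have := H h 0 hd.
  by rewrite normr0 d0 addr0 mulr0 !addr0 mul1r; apply.
apply: (@K _ _ B) => h hd; have := H 0 h; rewrite normr0 d0 addr0 mulr0 add0r mul1r add0r.
by apply.
Unshelve. all: by end_near. Qed.

(** One-sided mean value property. By Goursat in polar coordinates the integral of Re f over the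
    angle is the same on the circle of radius [r] and on a small circle around [p], where it is
    close to 2 pi Re f(p) by continuity. Differentiability is assumed only off the centre, so that a
    quotient can be handled at its removable singularity. *)
Lemma no_circle_drop (f : R[i] -> R[i]) p r dl : 0 < r -> 0 < dl -> ccont f p ->
  (forall z, z != p -> cabs (z - p) <= r -> exists l, cdiff f z l) ->
  ~ (forall z, cabs (z - p) = r -> Re (f z) <= Re (f p) - dl).
Proof.
move=> r0 dl0 cf df drop.
have [d [d0 H]] := cf (dl / 2) ltac:(lra).
(* The inner radius [expR a] is below [d], so on the inner circle Re f stays within [dl / 2] of its
   value at [p]. *)
pose b := ln r; pose a := Num.min b (ln (d / 2)).
have ab : a <= b by rewrite /a ge_min lexx.
have eb : expR b = r by rewrite lnK.
have ea : expR a < d.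
  have : expR a <= expR (ln (d / 2)) by rewrite ler_expR /a ge_min lexx orbT.
  by rewrite lnK ?posrE; lra.
pose P s t := Im (f (p + cpolar s t)); pose Q s t := Re (f (p + cpolar s t)).
have pPQ s t : a <= s <= b -> exists A B C, diff2 P s t A B /\ diff2 Q s t B C.
  move=> /andP[_ sb]; have [||l dl1] := df (p + cpolar s t).
  - by rewrite addrC -subr_eq0 addrK -cabs_eq0 cabs_cpolar gt_eqF ?expR_gt0.
  - by rewrite addrC addKr cabs_cpolar -eb ler_expR.
  - by have [? ?] := polar_CauchyRiemann dl1; do 3 eexists; split; eassumption.
have pi2 : 0 <= 2 * pi :> R by rewrite mulr_ge0 // pi_ge0.
have [cP HcP] : {cP : R -> R -> R & forall t s, a <= s <= b ->
    is_derive s 1 (cP t) (P s t)}.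
  apply: (@choice R (R -> R) (fun t U => forall s, a <= s <= b -> is_derive s 1 U (P s t))) => t.
  apply: (@primitive_exists R (fun s => P s t)) => // s sab.
  by have [A [B [C [dP _]]]] := pPQ s t sab; have [] := diff2_continuous dP.
have [cQ HcQ] : {cQ : R -> R -> R & forall s, a <= s <= b ->
    forall t, 0 <= t <= 2 * pi -> is_derive t 1 (cQ s) (Q s t)}.
  apply: (@choice R (R -> R) (fun s U => a <= s <= b ->
    forall t, 0 <= t <= 2 * pi -> is_derive t 1 U (Q s t))) => s.
  have [sab|nsab] := boolP (a <= s <= b); last by exists (fun _ => 0).
  have [|U HU] := @primitive_exists R (Q s) 0 (2 * pi) pi2; last by exists U.
  move=> t _.
  by have [A [B [C [_ dQ]]]] := pPQ s t sab; have [] := diff2_continuous dQ.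
have := @goursat_rectangle R P Q (fun s t => cP t s) cQ a b 0 (2 * pi)
  (fun s t sab _ => HcP t s sab) (fun s t sab tab => HcQ s sab t tab)
  (fun s t sab _ => pPQ s t sab) ab pi2.
(* The sides t = 0 and t = 2 pi represent the same segment by periodicity, so their contributions
   cancel and only the two circles remain. *)
have : `|(cP (2 * pi) b - cP 0 b) - (cP (2 * pi) a - cP 0 a)| <= 0 * (b - a).
  apply: (@mvt_norm_le R (fun s => cP (2 * pi) s - cP 0 s) (fun s => P s (2 * pi) - P s 0)) => //.
    by move=> s sab; apply: is_deriveB; exact: HcP.
  move=> s _; have -> : P s (2 * pi) = P s 0.
    by rewrite /P /cpolar mulr_natl cos2pi sin2pi cos0 sin0.
  by rewrite subrr normr0.
rewrite mul0r normr_le0 => /eqP E1 E2.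
(* The outer average is at most Re f(p) - dl and the inner one at least Re f(p) - dl / 2, while
   Goursat makes them equal. *)
have up : cQ b (2 * pi) - cQ b 0 <= (Re (f p) - dl) * (2 * pi - 0).
  apply: (@mvt_le R _ (Q b)) => // t; first by apply: HcQ; rewrite ab lexx.
  by move=> _; apply: drop; rewrite addrC addKr cabs_cpolar.
have lo : `|(cQ a (2 * pi) - Re (f p) * (2 * pi)) - (cQ a 0 - Re (f p) * 0)|
    <= dl / 2 * (2 * pi - 0).
  apply: (@mvt_norm_le R (fun t => cQ a t - Re (f p) * t) (fun t => Q a t - Re (f p))) => //.
    move=> t tab; apply: is_deriveB; first by apply: HcQ; rewrite ?ab ?lexx.
    exact: is_derive_mull.
  move=> t _; have := H (cpolar a t); rewrite cabs_cpolar => /(_ ea) H1.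
  by apply: le_trans H1; apply: le_trans (Re_le_cabs _); rewrite RecD RecN.
have := pi_gt0 R => pi0.
move: lo; rewrite ler_norml => /andP[lo _].
nra.
Qed.

End MeanValue.

(** * Schwarz lemma *)

Arguments cabs : simpl never.

Section Schwarz.
Variable R : realType.
Implicit Types (z w p l : R[i]) (x y e d s t : R) (f g : R[i] -> R[i]).

Lemma cdiff_ccont f z l : cdiff f z l -> ccont f z.
Proof.
move=> df e e0; have [d [d0 H]] := df 1 ltr01.
have l1 : 0 < cabs l + 1 by have := cabs_ge0 l; lra.
have e1 : 0 < e / (cabs l + 1) by rewrite divr_gt0.
exists (Num.min d (e / (cabs l + 1))); split; first by rewrite lt_min d0.
move=> h; rewrite lt_min => /andP[hd]; rewrite ltr_pdivlMr // => he.
have := cabsD (f (z + h) - f z - l * h) (l * h); rewrite subrK cabsM.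
have := H h hd; lra.
Qed.

Lemma cdiff_near f g z l r : 0 < r ->
  (forall w, cabs (w - z) < r -> g w = f w) -> cdiff f z l -> cdiff g z l.
Proof.
move=> r0 fg df e e0; have [d [d0 H]] := df e e0.
exists (Num.min d r); split; first by rewrite lt_min d0.
move=> h; rewrite lt_min => /andP[hd hr].
by rewrite !fg ?subrr ?cabs0 // ?H // addrC addKr.
Qed.

Lemma cdiff_const c z : cdiff (fun _ => c) z 0.
Proof.
move=> e e0; exists 1; split=> // h _; rewrite subrr mul0r subr0 cabs0.
by rewrite mulr_ge0 ?cabs_ge0 // ltW.
Qed.

Lemma cdiff_id z : cdiff id z 1.
Proof.
move=> e e0; exists 1; split=> // h _; rewrite mul1r addrAC addrK subrr cabs0.
by rewrite mulr_ge0 ?cabs_ge0 // ltW.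
Qed.

Lemma cdiffD f g z l m : cdiff f z l -> cdiff g z m ->
  cdiff (fun w => f w + g w) z (l + m).
Proof.
move=> df dg e e0; have e2 : 0 < e / 2 by lra.
have [d1 [d10 H1]] := df _ e2; have [d2 [d20 H2]] := dg _ e2.
exists (Num.min d1 d2); split; first by rewrite lt_min d10.
move=> h; rewrite lt_min => /andP[h1 h2].
have -> : f (z + h) + g (z + h) - (f z + g z) - (l + m) * h =
  (f (z + h) - f z - l * h) + (g (z + h) - g z - m * h) by ring.
apply: le_trans (cabsD _ _) _; have := H1 h h1; have := H2 h h2; lra.
Qed.

Lemma cdiffM f g z l m : cdiff f z l -> cdiff g z m ->
  cdiff (fun w => f w * g w) z (l * g z + f z * m).
Proof.
move=> df dg e e0; have cg := cdiff_ccont dg.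
have pos w : 0 < cabs w + 1 by have := cabs_ge0 w; lra.
have pe w : 0 < e / 3 / (cabs w + 1) by rewrite !divr_gt0.
have shrink w u : 0 <= u -> cabs w * (e / 3 / (cabs w + 1) * u) <= e / 3 * u.
  move=> u0; have -> : cabs w * (e / 3 / (cabs w + 1) * u) =
      (cabs w / (cabs w + 1)) * (e / 3 * u) by field; rewrite gt_eqF.
  rewrite ler_piMl //; first by rewrite mulr_ge0 //; lra.
  by rewrite ler_pdivrMr //; lra.
have [d1 [d10 H1]] := df _ (pe (g z)); have [d2 [d20 H2]] := cg _ (pe l).
have [d3 [d30 H3]] := dg _ (pe (f z)); have [d4 [d40 H4]] := cg _ ltr01.
exists (Num.min (Num.min d1 d2) (Num.min d3 d4)); split.
  by rewrite !lt_min d10 d20 d30.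
move=> h; rewrite !lt_min => /andP[/andP[h1 h2] /andP[h3 h4]].
have h0 := cabs_ge0 h.
have -> : f (z + h) * g (z + h) - f z * g z - (l * g z + f z * m) * h =
   (f (z + h) - f z - l * h) * g (z + h) + l * ((g (z + h) - g z) * h)
   + f z * (g (z + h) - g z - m * h) by ring.
have T1 : cabs ((f (z + h) - f z - l * h) * g (z + h)) <= e / 3 * cabs h.
  have G1 : cabs (g (z + h)) <= cabs (g z) + 1.
    have := cabsD (g (z + h) - g z) (g z); rewrite subrK; have := H4 h h4; lra.
  rewrite cabsM.
  apply: le_trans (ler_pM (cabs_ge0 _) (cabs_ge0 _) (H1 h h1) G1) _.
  by rewrite mulrAC divfK // gt_eqF.
have T2 : cabs (l * ((g (z + h) - g z) * h)) <= e / 3 * cabs h.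
  rewrite !cabsM; apply: le_trans (shrink l _ h0).
  by rewrite ler_wpM2l ?cabs_ge0 // ler_wpM2r // H2.
have T3 : cabs (f z * (g (z + h) - g z - m * h)) <= e / 3 * cabs h.
  rewrite cabsM; apply: le_trans (shrink (f z) _ h0).
  by rewrite ler_wpM2l ?cabs_ge0 // H3.
apply: le_trans (cabsD _ _) _; have := cabsD ((f (z + h) - f z - l * h) * g (z + h))
  (l * ((g (z + h) - g z) * h)); lra.
Qed.

Lemma cdiffV f z l : cdiff f z l -> f z != 0 ->
  cdiff (fun w => (f w)^-1) z (- l / f z ^+ 2).
Proof.
move=> df fz0 e e0; have cf := cdiff_ccont df.
set M := cabs (f z); have M0 : 0 < M by rewrite cabs_gt0.
set L := cabs l; have L0 : 0 <= L by exact: cabs_ge0.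
have e1 : 0 < e * M ^+ 2 / 4 by rewrite divr_gt0 // mulr_gt0 // exprn_gt0.
have e2 : 0 < e * M ^+ 3 / (4 * (L + 1)).
  by rewrite divr_gt0 // mulr_gt0 // ?exprn_gt0 //; lra.
have e3 : 0 < M / 2 by lra.
have [d1 [d10 H1]] := df _ e1; have [d2 [d20 H2]] := cf _ e2.
have [d3 [d30 H3]] := cf _ e3.
exists (Num.min d1 (Num.min d2 d3)); split; first by rewrite !lt_min d10 d20.
move=> h; rewrite !lt_min => /andP[h1 /andP[h2 h3]].
have h0 := cabs_ge0 h; set F := f (z + h).
have F0 : M / 2 <= cabs F.
  have := cabsB F (F - f z); rewrite opprB addrC subrK -/M.
  have := H3 h h3; rewrite -/F; lra.
have Fp : 0 < cabs F by lra.
have Fz0 : F != 0 by rewrite -cabs_gt0.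
(* In the numerator the first term is small by continuity and the second by differentiability; in
   the denominator [F] is kept away from 0 by [F0]. *)
have -> : F^-1 - (f z)^-1 - - l / f z ^+ 2 * h =
   (l * ((F - f z) * h) - f z * (F - f z - l * h)) / (F * f z ^+ 2).
  by field; rewrite fz0 Fz0.
rewrite cabsM cabsV ler_pdivrMr ?cabs_gt0 ?mulf_neq0 ?expf_neq0 //.
have -> : cabs (F * f z ^+ 2) = cabs F * M ^+ 2 by rewrite !cabsM expr2.
apply: le_trans (cabsB _ _) _; rewrite !cabsM -/L -/M.
have T1 : L * (cabs (F - f z) * cabs h) <= e * M ^+ 3 / 4 * cabs h.
  rewrite mulrA ler_wpM2r //; apply: le_trans (ler_wpM2l L0 (H2 h h2)) _.
  have -> : L * (e * M ^+ 3 / (4 * (L + 1))) = (L / (L + 1)) * (e * M ^+ 3 / 4).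
    by field; rewrite gt_eqF //; lra.
  rewrite ler_piMl //; first by rewrite divr_ge0 // mulr_ge0 ?exprn_ge0 // ltW.
  by rewrite ler_pdivrMr; lra.
have T2 : M * cabs (F - f z - l * h) <= e * M ^+ 3 / 4 * cabs h.
  apply: le_trans (ler_wpM2l (ltW M0) (H1 h h1)) _.
  by rewrite le_eqVlt; apply/orP; left; apply/eqP; field.
have T3 : e * M ^+ 3 / 2 * cabs h <= e * cabs h * (cabs F * M ^+ 2).
  have -> : e * M ^+ 3 / 2 * cabs h = e * cabs h * (M / 2 * M ^+ 2) by field.
  rewrite ler_wpM2l ?mulr_ge0 // ?(ltW e0) // ler_wpM2r // exprn_ge0 //.
  exact: ltW.
lra.
Qed.

(** In real coordinates the closed disc is a closed subset of a compact square, so the extreme value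
    theorem applies. *)
Lemma disc_max (W : R[i] -> R) rho : 0 <= rho ->
  (forall z, cabs z <= rho -> forall e, 0 < e -> exists d, 0 < d /\
     forall h, cabs h < d -> `|W (z + h) - W z| <= e) ->
  exists2 p, cabs p <= rho & forall z, cabs z <= rho -> W z <= W p.
Proof.
move=> rho0 cW.
pose A : set (R * R) := [set q | q.1 ^+ 2 + q.2 ^+ 2 <= rho ^+ 2].
have cabsA (q : R * R) : A q = (cabs (q.1 +i* q.2)%C <= rho) :> Prop.
  by rewrite /A /= (le_cabs _ rho0).
have cA : compact A.
  have clA : closed A.
    rewrite (_ : A = (fun q : R * R => q.1 ^+ 2 + q.2 ^+ 2) @^-1` [set x | x <= rho ^+ 2]) //.
    apply: preimage_closed; last exact: closed_le.
    move=> q _; apply: cvgD; apply: cvgM; (exact: cvg_fst || exact: cvg_snd).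
  have csq : compact ((`[- rho, rho] : set R) `*` (`[- rho, rho] : set R)).
    by apply: compact_setX; exact: segment_compact.
  apply: (subclosed_compact clA csq) => -[x y] /=.
  rewrite cabsA /= !in_itv /= -!ler_norml => h.
  by split; [apply: le_trans (Re_le_cabs (x +i* y)%C) h
            |apply: le_trans (Im_le_cabs (x +i* y)%C) h].
have [|||q] := @compact_EVT_max _ R (fun q : R * R => W (q.1 +i* q.2)%C) A => //.
- by exists (0, 0); rewrite cabsA /= [cabs _]cabs0.
- apply: continuous_in_subspaceT => q; rewrite inE cabsA => qA.
  apply/cvgrPdist_le => e e0; have [d [d0 H]] := cW _ qA e e0.
  have d2 : 0 < d / 2 by lra.
  have N1 : \forall q' \near q, `|q.1 - q'.1| < d / 2.
    have /cvgrPdist_lt C : x.1 @[x --> q] --> q.1 by exact: cvg_fst.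
    exact: C.
  have N2 : \forall q' \near q, `|q.2 - q'.2| < d / 2.
    have /cvgrPdist_lt C : x.2 @[x --> q] --> q.2 by exact: cvg_snd.
    exact: C.
  near=> q'.
  have n1 : `|q.1 - q'.1| < d / 2.
    by near: q'; exact: N1.
  have n2 : `|q.2 - q'.2| < d / 2.
    by near: q'; exact: N2.
  have := H ((q'.1 - q.1) +i* (q'.2 - q.2))%C.
  have -> : (q.1 +i* q.2)%C + ((q'.1 - q.1) +i* (q'.2 - q.2))%C = (q'.1 +i* q'.2)%C.
    by apply/eqP; rewrite eq_complex /= !subrKC !eqxx.
  rewrite distrC; apply; apply: le_lt_trans (cabs_le_ReIm _) _ => /=.
  rewrite (distrC q'.1) (distrC q'.2); lra.
- rewrite inE cabsA => qA mx; exists (q.1 +i* q.2)%C => // -[x y] zA.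
  by apply: (mx (x, y)); rewrite inE cabsA.
Unshelve. all: by end_near. Qed.

(** The quotient G(z) = H(z) / z satisfies |G| <= 1 / rho on the circle of radius rho, and the
    maximum principle carries this bound inside. The term [e * cabs z ^+ 2] makes the principle
    strict, which is what [no_circle_drop] can refute; then e tends to 0 and rho to 1. *)
Theorem schwarz_lemma (H : R[i] -> R[i]) :
  (forall z, cabs z < 1 -> exists l, cdiff H z l) ->
  (forall z, cabs z < 1 -> cabs (H z) <= 1) -> H 0 = 0 ->
  forall z, cabs z < 1 -> cabs (H z) <= cabs z.
Proof.
move=> dH bH H0.
have [l0 dl0] : exists l, cdiff H 0 l by apply: dH; rewrite cabs0.
(* The value at 0 is the derivative of [H] there, which makes [G] continuous on the whole disc. *)
pose G z := if z == 0 then l0 else H z * z^-1.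
have HG z : H z = z * G z.
  rewrite /G; case: eqVneq => [->|z0]; first by rewrite H0 mul0r.
  by rewrite mulrCA mulfV // mulr1.
have dG z : z != 0 -> cabs z < 1 -> exists l, cdiff G z l.
  move=> z0 z1; have [l dl] := dH z z1; eexists.
  apply: (@cdiff_near (fun w => H w * w^-1) _ _ _ (cabs z)); first by rewrite cabs_gt0.
    move=> w wz; rewrite /G; case: eqVneq => // w0.
    by move: wz; rewrite w0 sub0r cabsN ltxx.
  exact: cdiffM dl (cdiffV (cdiff_id z) z0).
have cG z : cabs z < 1 -> ccont G z.
  have [->|z0] := eqVneq z 0; last by move=> z1; have [l /cdiff_ccont] := dG z z0 z1.
  move=> _ e e0; have [d [d0 Hd]] := dl0 e e0; exists d; split=> // h hd.
  have := Hd h hd; rewrite add0r H0 subr0 HG /G eqxx; case: eqVneq => [_|h0].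
    by rewrite subrr cabs0 => _; exact: ltW.
  by rewrite (mulrC l0) -mulrBr cabsM mulrC ler_pM2r // cabs_gt0.
have max rho e z : 0 < rho -> rho < 1 -> 0 < e -> cabs z <= rho ->
    cabs (G z) ^+ 2 + e * cabs z ^+ 2 <= (rho^-1) ^+ 2 + e.
  move=> r0 r1 e0 zr.
  pose W w := cabs (G w) ^+ 2 + e * cabs w ^+ 2.
  have [||p pr pmax] := @disc_max W rho; first exact: ltW.
    move=> w wr e' e'0.
    have w1 : cabs w < 1 by lra.
    set K := 2 * (cabs (G w) + 1) + e * 3.
    have K0 : 0 < K by rewrite /K; have := cabs_ge0 (G w); lra.
    pose e1 := Num.min 1 (e' / K).
    have e10 : 0 < e1 by rewrite /e1 lt_min ltr01 divr_gt0.
    have [d [d0 Hd]] := cG w w1 e1 e10.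
    exists (Num.min d e1); split; first by rewrite lt_min d0.
    move=> h; rewrite lt_min => /andP[hd he1].
    have dist (u v : R[i]) : `|cabs u - cabs v| <= cabs (u - v).
      rewrite ler_norml; have := cabsD (u - v) v; have := cabsD (v - u) u.
      by rewrite !subrK -(cabsN (v - u)) opprB; lra.
    have B1 : `|cabs (G (w + h)) - cabs (G w)| <= e1 by exact: le_trans (dist _ _) (Hd h hd).
    have B2 : `|cabs (w + h) - cabs w| <= e1.
      by apply: le_trans (dist _ _) _; rewrite addrC addKr ltW.
    have e1K : e1 * K <= e' by rewrite -ler_pdivlMr // /e1 ge_min lexx orbT.
    have e11 : e1 <= 1 by rewrite /e1 ge_min lexx.
    rewrite /W; set A1 := cabs (G (w + h)) in B1 *; set A0 := cabs (G w) in B1 *.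
    set C1 := cabs (w + h) in B2 *; set C0 := cabs w in w1 B2 *.
    have -> : A1 ^+ 2 + e * C1 ^+ 2 - (A0 ^+ 2 + e * C0 ^+ 2) =
       (A1 - A0) * (A1 - A0 + 2 * A0) + e * ((C1 - C0) * (C1 - C0 + 2 * C0)) by ring.
    have A00 : 0 <= A0 by exact: cabs_ge0.
    have C00 : 0 <= C0 by exact: cabs_ge0.
    apply: le_trans (ler_normD _ _) _; rewrite !normrM (gtr0_norm e0).
    have N1 : `|A1 - A0 + 2 * A0| <= 1 + 2 * A0.
      by apply: le_trans (ler_normD _ _) _; rewrite (@ger0_norm _ (2 * A0)) ?mulr_ge0 //; lra.
    have N2 : `|C1 - C0 + 2 * C0| <= 3.
      by apply: le_trans (ler_normD _ _) _; rewrite (@ger0_norm _ (2 * C0)) ?mulr_ge0 //; lra.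
    have M1 := ler_pM (normr_ge0 _) (normr_ge0 _) B1 N1.
    have M2 := ler_wpM2l (ltW e0) (ler_pM (normr_ge0 _) (normr_ge0 _) B2 N2).
    apply: le_trans (lerD M1 M2) _; apply: le_trans e1K; rewrite /K -/A0.
    have e1g : 0 <= e1 by exact: ltW.
    by nra.
  apply: le_trans (pmax z zr) _; rewrite /W.
  have [pe|pne] := eqVneq (cabs p) rho.
    have p0 : p != 0 by rewrite -cabs_gt0 pe.
    rewrite pe lerD //.
      rewrite /G (negPf p0) cabsM cabsV pe ler_pXn2r ?nnegrE ?mulr_ge0 ?cabs_ge0 ?invr_ge0 ?(ltW r0) //.
      by rewrite ler_piMl ?invr_ge0 ?(ltW r0) // bH // pe.
    by rewrite -{2}(mulr1 e) ler_pM2l // expr_le1 // ltW.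
  have pl : cabs p < rho by rewrite lt_def eq_sym pne.
  exfalso.
  (* The closed disc around [p] must stay in the disc of radius rho and may contain 0, where only
     continuity of [G] is known, at most as its centre. *)
  pose r := if p == 0 then rho else Num.min (cabs p / 2) (rho - cabs p).
  have rr : [/\ 0 < r, r <= rho - cabs p & p != 0 -> r <= cabs p / 2].
    rewrite /r; case: eqVneq => [->|p0]; first by rewrite cabs0 subr0.
    have pp : 0 < cabs p by rewrite cabs_gt0.
    rewrite lt_min !ge_min !lexx orbT /=; split=> //; lra.
  case: rr => rp rr1 rr2.
  have in1 w : cabs (w - p) <= r -> cabs w <= rho.
    by move=> wr; have := cabsD (w - p) p; rewrite subrK; lra.
  (* Twice the linearisation of |G|^2 + e |w|^2 at [p], in terms of the increments of G and w. Since
     |u|^2 = |v|^2 + 2 Re(conj(v)(u - v)) + |u - v|^2, maximality at [p] makes Re F drop by at least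
     e |w - p|^2. *)
  pose F w := (2 * conjc (G p)) * G w + (2 * e%:C%C * conjc p) * w.
  apply: (@no_circle_drop R F p r (e * r ^+ 2)) => //.
  - by rewrite mulr_gt0 // exprn_gt0.
  - have p1 : cabs p < 1 by lra.
    move=> e' e'0; set a := 2 * conjc (G p); set b := 2 * e%:C%C * conjc p.
    have a1 : 0 < cabs a + 1 by have := cabs_ge0 a; lra.
    have b1 : 0 < cabs b + 1 by have := cabs_ge0 b; lra.
    have [d [d0 Hd]] := cG p p1 (e' / 2 / (cabs a + 1)) ltac:(by rewrite !divr_gt0).
    exists (Num.min d (e' / 2 / (cabs b + 1))).
    split; first by rewrite lt_min d0 !divr_gt0.
    move=> h; rewrite lt_min => /andP[hd hb].
    have -> : F (p + h) - F p = a * (G (p + h) - G p) + b * h by rewrite /F -/a -/b; ring.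
    apply: le_trans (cabsD _ _) _; rewrite (cabsM a) (cabsM b).
    have := Hd h hd; rewrite ler_pdivlMr // => Q1.
    move: hb; rewrite ltr_pdivlMr // => Q2.
    have := cabs_ge0 (G (p + h) - G p); have := cabs_ge0 h; lra.
  - move=> w wp wr.
    have w0 : w != 0.
      have [p0|p0] := eqVneq p 0; first by rewrite -p0.
      apply/eqP => w0; move: wr (rr2 p0); rewrite w0 sub0r cabsN.
      have : 0 < cabs p by rewrite cabs_gt0.
      lra.
    have [l dl] : exists l, cdiff G w l by apply: dG => //; have := in1 w wr; lra.
    eexists; apply: cdiffD; apply: cdiffM; try exact: cdiff_const; first exact: dl.
    exact: cdiff_id.
  - move=> w wr; have := pmax w (in1 w _); rewrite wr lexx => /(_ isT).
    rewrite /W /F -wr !cabs_sqr.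
    case: (G w) => g1 g2; case: (G p) => g3 g4; case: (w) => w1 w2; case: (p) => p1 p2 /=.
    have := sqr_ge0 (g1 - g3); have := sqr_ge0 (g2 - g4).
    nra.
move=> z z1; have [z0|z0] := eqVneq z 0; first by rewrite z0 H0 cabs0.
have zp : 0 < cabs z by rewrite cabs_gt0.
have key rho : rho < 1 -> cabs z <= rho -> rho * cabs (H z) <= cabs z.
  move=> r1 zr; have r0 : 0 < rho by lra.
  have G1 : cabs (G z) <= rho^-1.
    rewrite -(@ler_pXn2r _ 2) ?nnegrE ?cabs_ge0 ?invr_ge0 ?(ltW r0) //.
    apply/ler_addgt0Pr => e e0.
    apply: le_trans (max rho e z r0 r1 e0 zr); rewrite lerDl.
    by rewrite mulr_ge0 ?exprn_ge0 ?cabs_ge0 // ltW.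
  rewrite HG cabsM mulrCA ler_piMr ?cabs_ge0 //.
  by rewrite -ler_pdivlMl // mulr1.
rewrite leNgt; apply/negP => lt.
have Hp : 0 < cabs (H z) by lra.
have H1 := bH z z1.
have q1 : cabs z / cabs (H z) < 1 by rewrite ltr_pdivrMr // mul1r.
have q2 : cabs z <= cabs z / cabs (H z) by rewrite ler_pdivlMr // ler_piMr // ltW.
(* If |H(z)| > |z|, the radius halfway between |z| / |H(z)| and 1 is admissible and gives (|H(z)| +
   |z|) / 2 <= |z|, a contradiction. *)
have := key ((1 + cabs z / cabs (H z)) / 2) ltac:(lra) ltac:(lra).
have -> : (1 + cabs z / cabs (H z)) / 2 * cabs (H z) = (cabs (H z) + cabs z) / 2.
  by field; rewrite gt_eqF.
lra.
Qed.

End Schwarz.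

(** * Hermitian geometry of the ball *)

Section HermitianProduct.
Variable R : realType.
Implicit Types (x y e d : R) (c z : R[i]).

Definition hdot m (u v : 'cV[R[i]]_m) : R[i] := \sum_(i < m) u i 0 * conjc (v i 0).

Lemma Re_sum (I : finType) (F : I -> R[i]) : Re (\sum_i F i) = \sum_i Re (F i).
Proof. by elim/big_rec2: _ => // i x y _ <-; rewrite RecD. Qed.

Lemma conjcM z c : conjc (z * c) = conjc z * conjc c. Proof. exact: rmorphM. Qed.
Lemma conjcD z c : conjc (z + c) = conjc z + conjc c. Proof. exact: rmorphD. Qed.
Lemma conjcB z c : conjc (z - c) = conjc z - conjc c. Proof. exact: rmorphB. Qed.

Lemma rcM x y : ((x * y)%:C = x%:C * y%:C)%C. Proof. exact: rmorphM. Qed.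
Lemma rcB x y : ((x - y)%:C = x%:C - y%:C)%C. Proof. exact: rmorphB. Qed.

Lemma mul_conjc z : z * conjc z = ((cabs z ^+ 2)%:C)%C.
Proof.
rewrite cabs_sqr; case: z => a b; apply/eqP; rewrite eq_complex /=.
by apply/andP; split; apply/eqP; ring.
Qed.

Lemma hdotDl m (u v w : 'cV[R[i]]_m) : hdot (u + v) w = hdot u w + hdot v w.
Proof. by rewrite /hdot -big_split; apply: eq_bigr => i _; rewrite mxE mulrDl. Qed.
Lemma hdotZl m c (u w : 'cV[R[i]]_m) : hdot (c *: u) w = c * hdot u w.
Proof. by rewrite /hdot mulr_sumr; apply: eq_bigr => i _; rewrite mxE mulrA. Qed.
Lemma hdotNl m (u w : 'cV[R[i]]_m) : hdot (- u) w = - hdot u w.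
Proof. by rewrite -scaleN1r hdotZl mulN1r. Qed.
Lemma hdotBl m (u v w : 'cV[R[i]]_m) : hdot (u - v) w = hdot u w - hdot v w.
Proof. by rewrite hdotDl hdotNl. Qed.
Lemma hdotC m (u w : 'cV[R[i]]_m) : conjc (hdot u w) = hdot w u.
Proof.
rewrite /hdot (big_morph conjc conjcD (conjc0 _)); apply: eq_bigr => i _.
by rewrite conjcM conjcK mulrC.
Qed.
Lemma hdotBr m (u v w : 'cV[R[i]]_m) : hdot w (u - v) = hdot w u - hdot w v.
Proof. by rewrite -hdotC hdotBl conjcB !hdotC. Qed.
Lemma hdotZr m c (u w : 'cV[R[i]]_m) : hdot w (c *: u) = conjc c * hdot w u.
Proof. by rewrite -hdotC hdotZl conjcM hdotC. Qed.
Lemma hdot_col m k (u u' : 'cV[R[i]]_m) (v v' : 'cV[R[i]]_k) :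
  hdot (col_mx u v) (col_mx u' v') = hdot u u' + hdot v v'.
Proof.
rewrite /hdot big_split_ord /=; congr (_ + _); apply: eq_bigr => i _.
  by rewrite !col_mxEu.
by rewrite !col_mxEd.
Qed.
Lemma hdot_const c c' : hdot (const_mx c : 'cV_1) (const_mx c') = c * conjc c'.
Proof. by rewrite /hdot big_ord1 !mxE. Qed.

Lemma vnorm_ge0 m (u : 'cV[R[i]]_m) : 0 <= vnorm u.
Proof. exact: sqrtr_ge0. Qed.
Lemma vnorm_sqr m (u : 'cV[R[i]]_m) : vnorm u ^+ 2 = \sum_i cabs (u i 0) ^+ 2.
Proof. by rewrite sqr_sqrtr // sumr_ge0 // => i _; exact: sqr_ge0. Qed.
Lemma hdot_vnorm m (u : 'cV[R[i]]_m) : hdot u u = ((vnorm u ^+ 2)%:C)%C.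
Proof.
rewrite vnorm_sqr (big_morph (real_complex R) (rmorphD _) (rmorph0 _)).
by apply: eq_bigr => i _; exact: mul_conjc.
Qed.
Lemma cabs_le_vnorm m (u : 'cV[R[i]]_m) i : cabs (u i 0) <= vnorm u.
Proof.
rewrite -(@ler_pXn2r _ 2) ?nnegrE ?cabs_ge0 ?vnorm_ge0 // vnorm_sqr (bigD1 i) //=.
by rewrite lerDl sumr_ge0 // => j _; exact: sqr_ge0.
Qed.
Lemma vnormZ m c (u : 'cV[R[i]]_m) : vnorm (c *: u) = cabs c * vnorm u.
Proof.
apply/eqP; rewrite -(@eqrXn2 _ 2) ?vnorm_ge0 ?mulr_ge0 ?vnorm_ge0 ?cabs_ge0 //.
rewrite exprMn !vnorm_sqr mulr_sumr; apply/eqP/eq_bigr => i _.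
by rewrite mxE cabsM exprMn.
Qed.

(** Expanding the squared norm of B u - c v, with B = |v|^2 and c = <u, v>, gives B (B |u|^2 -
    |c|^2), which is nonnegative. *)
Lemma cauchy_schwarz m (u v : 'cV[R[i]]_m) : cabs (hdot u v) <= vnorm u * vnorm v.
Proof.
set c := hdot u v; set B := vnorm v ^+ 2.
have B0 : 0 <= B by exact: sqr_ge0.
have [vz|vp] := eqVneq (vnorm v) 0.
  rewrite /c /hdot big1 ?cabs0 ?vz ?mulr0 // => i _.
  have := cabs_le_vnorm v i; rewrite vz => h.
  have /eqP : cabs (v i 0) == 0 by rewrite eq_le h cabs_ge0.
  by move/eqP; rewrite cabs_eq0 => /eqP ->; rewrite conjc0 mulr0.
have Bp : 0 < B by rewrite exprn_gt0 // lt_def vp vnorm_ge0.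
have : 0 <= vnorm (B%:C%C *: u - c *: v) ^+ 2 by exact: sqr_ge0.
have -> : vnorm (B%:C%C *: u - c *: v) ^+ 2 = B * (B * vnorm u ^+ 2 - cabs c ^+ 2).
  apply: (@complexI R); rewrite -hdot_vnorm hdotBl !hdotBr !hdotZl !hdotZr.
  rewrite !hdot_vnorm -/B -/c -(hdotC u v) -/c conjc_real.
  rewrite (rcM B) rcB (rcM B) -mul_conjc.
  by ring.
rewrite pmulr_rge0 // subr_ge0 => h.
rewrite -(@ler_pXn2r _ 2) ?nnegrE ?cabs_ge0 ?mulr_ge0 ?vnorm_ge0 //.
by rewrite exprMn mulrC.
Qed.

Lemma vnormD m (u v : 'cV[R[i]]_m) : vnorm (u + v) <= vnorm u + vnorm v.
Proof.
rewrite -(@ler_pXn2r _ 2) ?nnegrE ?addr_ge0 ?vnorm_ge0 //.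
have -> : vnorm (u + v) ^+ 2 = vnorm u ^+ 2 + vnorm v ^+ 2 + 2 * Re (hdot u v).
  rewrite !vnorm_sqr /hdot Re_sum mulr_sumr -!big_split /=; apply: eq_bigr => i _.
  rewrite mxE !cabs_sqr; case: (u i 0) (v i 0) => a b [a' b'] /=; ring.
have := cauchy_schwarz u v; have := Re_le_cabs (hdot u v); have := ler_norm (Re (hdot u v)).
by nra.
Qed.

Lemma vnormN m (u : 'cV[R[i]]_m) : vnorm (- u) = vnorm u.
Proof. by rewrite -scaleN1r vnormZ cabsN cabs1 mul1r. Qed.

Lemma cabs_conj_1B z : cabs (1 - conjc z) = cabs (1 - z).
Proof. by rewrite -(cabs_conj (1 - z)) conjcB conjc1. Qed.

(* [ball_form a w] is, up to the factor [1 - <w, a>], the image of w under the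
   automorphism of the ball that exchanges a and 0. *)
Definition ball_form m (a w : 'cV[R[i]]_m) : 'cV[R[i]]_(m + 1) :=
  col_mx ((Num.sqrt (1 - vnorm a ^+ 2))%:C%C *: (w - a)) (const_mx (hdot (w - a) a)).

(** Polarised form of the classical identity for 1 - <phi(w), phi(w')>, where phi is the
    automorphism exchanging a and 0, with denominators cleared. The additional coordinate of
    [ball_form] replaces the orthogonal projection onto the line of a, so a = 0 is no special
    case. *)
Lemma hdot_ball_form m (a w w' : 'cV[R[i]]_m) : vnorm a <= 1 ->
  hdot (ball_form a w) (ball_form a w') =
  (1 - hdot w a) * (1 - hdot a w') - (1 - hdot a a) * (1 - hdot w w').
Proof.
move=> a1; set k := 1 - vnorm a ^+ 2.
have k0 : 0 <= k by rewrite subr_ge0 expr_le1 // vnorm_ge0.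
rewrite hdot_col hdot_const hdotZl hdotZr conjc_real mulrA -rcM -expr2 sqr_sqrtr //.
have -> : (k%:C)%C = 1 - hdot a a by rewrite hdot_vnorm rcB.
rewrite hdotC !(hdotBl, hdotBr); ring.
Qed.

Lemma vnorm_ball_form m (a w : 'cV[R[i]]_m) : vnorm a <= 1 -> vnorm w <= 1 ->
  vnorm (ball_form a w) <= cabs (1 - hdot w a).
Proof.
move=> a1 w1; rewrite -(@ler_pXn2r _ 2) ?nnegrE ?vnorm_ge0 ?cabs_ge0 //.
have -> : vnorm (ball_form a w) ^+ 2 =
    cabs (1 - hdot w a) ^+ 2 - (1 - vnorm a ^+ 2) * (1 - vnorm w ^+ 2).
  apply: (@complexI R); rewrite -hdot_vnorm hdot_ball_form // !hdot_vnorm.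
  by rewrite rcB -mul_conjc (rcM (1 - _)) !rcB conjcB conjc1 hdotC.
by rewrite gerBl mulr_ge0 // subr_ge0 expr_le1 // vnorm_ge0.
Qed.

(** The bound |h| <= 1 with denominators cleared: Cauchy-Schwarz for the vectors [ball_form a w] and
    [ball_form a w']. Points of the sphere are allowed, as [w'] will be the boundary value w0. *)
Lemma ball_pick_le m (a w w' : 'cV[R[i]]_m) :
  vnorm a <= 1 -> vnorm w <= 1 -> vnorm w' <= 1 ->
  cabs ((1 - hdot w a) * (1 - hdot a w') - (1 - hdot a a) * (1 - hdot w w'))
    <= cabs ((1 - hdot w a) * (1 - hdot a w')).
Proof.
move=> a1 w1 w'1; rewrite -hdot_ball_form //; apply: le_trans (cauchy_schwarz _ _) _.
rewrite cabsM -(hdotC w' a) cabs_conj_1B.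
by apply: ler_pM; rewrite ?vnorm_ge0 ?vnorm_ball_form.
Qed.

Lemma one_sub_hdot_neq0 m (u v : 'cV[R[i]]_m) : vnorm u < 1 -> vnorm v <= 1 ->
  1 - hdot u v != 0.
Proof.
move=> u1 v1; rewrite subr_eq0; apply/eqP => h.
have := cauchy_schwarz u v; rewrite -h cabs1.
have := vnorm_ge0 u; have := vnorm_ge0 v; nra.
Qed.

End HermitianProduct.

(** * One-sided limits and rays in the polydisc *)

Section OneSidedLimits.
Variable R : realType.
Implicit Types (F G : R -> R[i]) (s e d : R) (k l : R[i]).

(** Limit as s decreases to 0; only s > 0 matters, since rays from a boundary point enter the
    polydisc on one side. *)
Definition tends0 F l := forall e, 0 < e -> exists d, 0 < d /\
  forall s, 0 < s < d -> cabs (F s - l) <= e.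

Lemma tends0_const l : tends0 (fun _ => l) l.
Proof. by move=> e e0; exists 1; split=> // s _; rewrite subrr cabs0 ltW. Qed.

Lemma tends0_id : tends0 (fun s => s%:C%C) 0.
Proof.
by move=> e e0; exists e; split=> // s /andP[s0 se]; rewrite subr0 cabs_real gtr0_norm // ltW.
Qed.

Lemma tends0D F G k l : tends0 F k -> tends0 G l -> tends0 (fun s => F s + G s) (k + l).
Proof.
move=> hF hG e e0; have e2 : 0 < e / 2 by lra.
have [d1 [d10 H1]] := hF _ e2; have [d2 [d20 H2]] := hG _ e2.
exists (Num.min d1 d2); split; first by rewrite lt_min d10.
move=> s /andP[s0]; rewrite lt_min => /andP[s1 s2].
have -> : F s + G s - (k + l) = (F s - k) + (G s - l) by ring.
apply: le_trans (cabsD _ _) _.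
have := H1 s; have := H2 s; rewrite s0 s1 s2 => /(_ isT) ? /(_ isT) ?; lra.
Qed.

Lemma tends0M F G k l : tends0 F k -> tends0 G l -> tends0 (fun s => F s * G s) (k * l).
Proof.
move=> hF hG e e0.
pose e1 := Num.min 1 (e / (cabs k + cabs l + 1)).
have kl1 : 0 < cabs k + cabs l + 1 by have := cabs_ge0 k; have := cabs_ge0 l; lra.
have e10 : 0 < e1 by rewrite lt_min ltr01 divr_gt0.
have e11 : e1 <= 1 by rewrite ge_min lexx.
have e1e : e1 * (cabs k + cabs l + 1) <= e.
  by rewrite -ler_pdivlMr // ge_min lexx orbT.
have [d1 [d10 H1]] := hF _ e10; have [d2 [d20 H2]] := hG _ e10.
exists (Num.min d1 d2); split; first by rewrite lt_min d10.
move=> s /andP[s0]; rewrite lt_min => /andP[s1 s2].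
have := H1 s; have := H2 s; rewrite s0 s1 s2 => /(_ isT) B2 /(_ isT) B1.
have -> : F s * G s - k * l = (F s - k) * (G s - l) + (F s - k) * l + k * (G s - l) by ring.
apply: le_trans (cabsD _ _) _.
have := cabsD ((F s - k) * (G s - l)) ((F s - k) * l); rewrite !cabsM.
have := cabs_ge0 (F s - k); have := cabs_ge0 (G s - l); have := cabs_ge0 k; have := cabs_ge0 l.
move=> ? ? ? ?.
have P1 : cabs (F s - k) * cabs (G s - l) <= e1 * 1 by apply: ler_pM => //; lra.
have P2 : cabs (F s - k) * cabs l <= e1 * cabs l by rewrite ler_wpM2r.
have P3 : cabs k * cabs (G s - l) <= cabs k * e1 by rewrite ler_wpM2l.
lra.
Qed.

Lemma tends0N F k : tends0 F k -> tends0 (fun s => - F s) (- k).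
Proof.
move=> hF e e0; have [d [d0 H]] := hF e e0; exists d; split=> // s sd.
by rewrite -opprD cabsN H.
Qed.

Lemma tends0_conj F k : tends0 F k -> tends0 (fun s => conjc (F s)) (conjc k).
Proof.
move=> hF e e0; have [d [d0 H]] := hF e e0; exists d; split=> // s sd.
by rewrite -conjcB cabs_conj H.
Qed.

Lemma tends0_near F G k d : 0 < d -> (forall s, 0 < s < d -> F s = G s) ->
  tends0 F k -> tends0 G k.
Proof.
move=> d0 FG hF e e0; have [d1 [d10 H]] := hF e e0.
exists (Num.min d d1); split; first by rewrite lt_min d0.
move=> s /andP[s0]; rewrite lt_min => /andP[s1 s2].
by rewrite -FG ?H ?s0 ?s1.
Qed.

Lemma tends0_Re_ge0 F k d : 0 < d -> (forall s, 0 < s < d -> 0 <= Re (F s)) ->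
  tends0 F k -> 0 <= Re k.
Proof.
move=> d0 Fge hF; apply/ler_addgt0Pr => e e0; have [d1 [d10 H]] := hF e e0.
pose s := Num.min d d1 / 2.
have m0 : 0 < Num.min d d1 by rewrite lt_min d0.
have md : Num.min d d1 <= d by rewrite ge_min lexx.
have md1 : Num.min d d1 <= d1 by rewrite ge_min lexx orbT.
have := Fge s ltac:(rewrite /s; lra); have := H s ltac:(rewrite /s; lra).
have := Re_le_cabs (F s - k); rewrite RecD RecN.
have := ler_norm (Re (F s) - Re k); lra.
Qed.

Lemma tends0_unique F k l : tends0 F k -> tends0 F l -> k = l.
Proof.
move=> hk hl; apply/eqP; rewrite -subr_eq0 -cabs_eq0 eq_le cabs_ge0 andbT.
apply/ler_addgt0Pr => e e0; rewrite add0r; have e2 : 0 < e / 2 by lra.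
have [d1 [d10 H1]] := hk _ e2; have [d2 [d20 H2]] := hl _ e2.
pose s := Num.min d1 d2 / 2.
have m0 : 0 < Num.min d1 d2 by rewrite lt_min d10.
have md : Num.min d1 d2 <= d1 by rewrite ge_min lexx.
have md1 : Num.min d1 d2 <= d2 by rewrite ge_min lexx orbT.
have := H1 s ltac:(rewrite /s; lra); have := H2 s ltac:(rewrite /s; lra).
have := cabsB (F s - l) (F s - k); have -> : F s - l - (F s - k) = k - l by ring.
lra.
Qed.

End OneSidedLimits.

(** * Rays that enter the polydisc *)

Section Polydisc.
Variable R : realType.
Implicit Types (s e d : R).

Lemma fin_uniform n (P : 'I_n -> R -> Prop) :
  (forall j, exists d, 0 < d /\ forall s, 0 < s < d -> P j s) ->
  exists d, 0 < d /\ forall s, 0 < s < d -> forall j, P j s.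
Proof.
move=> /choice[dj Hdj]; exists (\big[Num.min/1]_j dj j); split.
  by elim/big_ind: _ => // [x y x0 y0|j _]; [rewrite lt_min x0|case: (Hdj j)].
move=> s /andP[s0 sm] j; apply: (Hdj j).2; rewrite s0 /=.
apply: lt_le_trans sm _; by rewrite (bigD1 j) //= ge_min lexx.
Qed.

Lemma polydisc_ray n (p v : 'cV[R[i]]_n) : polydisc p ->
  exists d, 0 < d /\ forall s, 0 < s < d -> polydisc (p + s%:C%C *: v).
Proof.
move=> pp; apply: (@fin_uniform n (fun j s => cabs ((p + s%:C%C *: v) j 0) < 1)) => j.
have v1 : 0 < cabs (v j 0) + 1 by have := cabs_ge0 (v j 0); lra.
have pj := pp j.
exists ((1 - cabs (p j 0)) / (cabs (v j 0) + 1)); split.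
  by rewrite divr_gt0 // subr_gt0.
move=> s /andP[s0]; rewrite ltr_pdivlMr // => h.
rewrite !mxE; apply: le_lt_trans (cabsD _ _) _; rewrite cabsM cabs_real gtr0_norm //; nra.
Qed.

(* Moving towards 0 compensates a displacement tangential to the boundary to first order. *)
Lemma inward_direction n (z v : 'cV[R[i]]_n) dl : 0 < dl -> cl_polydisc z ->
  (forall j, cabs (z j 0) = 1 -> Re (v j 0 * conjc (z j 0)) <= 0) ->
  exists d, 0 < d /\ forall s, 0 < s < d ->
    polydisc (z + s%:C%C *: (v - dl%:C%C *: z)).
Proof.
move=> dl0 zc vz.
apply: (@fin_uniform n (fun j s => cabs ((z + s%:C%C *: (v - dl%:C%C *: z)) j 0) < 1)) => j.
have [z1|z1] := eqVneq (cabs (z j 0)) 1; last first.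
  have zj : cabs (z j 0) < 1 by rewrite lt_def eq_sym z1 zc.
  set u := (v - dl%:C%C *: z) j 0.
  have u1 : 0 < cabs u + 1 by have := cabs_ge0 u; lra.
  exists ((1 - cabs (z j 0)) / (cabs u + 1)); split.
    by rewrite divr_gt0 // subr_gt0.
  move=> s /andP[s0]; rewrite ltr_pdivlMr // => h.
  have -> : (z + s%:C%C *: (v - dl%:C%C *: z)) j 0 = z j 0 + s%:C%C * u by rewrite /u !mxE.
  apply: le_lt_trans (cabsD _ _) _.
  rewrite cabsM cabs_real gtr0_norm //; nra.
have := vz j z1; have := cabs_sqr (z j 0); rewrite z1 expr1n.
case zE: (z j 0) => [a b]; case vE : (v j 0) => [c d] /= zz vv.
(* When |z_j| = 1, the squared modulus of the displaced coordinate is at most 1 - 2 s dl + s^2 (dl^2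
   + |v_j|^2), which is below 1 as soon as s K < dl. *)
pose K := dl ^+ 2 + c ^+ 2 + d ^+ 2 + 1.
have K0 : 0 < K by rewrite /K; have := sqr_ge0 dl; have := sqr_ge0 c; have := sqr_ge0 d; lra.
exists (Num.min (dl^-1) (dl / K)); split; first by rewrite lt_min invr_gt0 dl0 divr_gt0.
move=> s /andP[s0]; rewrite lt_min => /andP[]; rewrite -[dl^-1]mul1r !ltr_pdivlMr // => h1 h2.
rewrite !mxE zE vE ltNge; apply/negP => ge1.
have : 1 <= cabs ((a +i* b)%C + s%:C%C * ((c +i* d)%C - dl%:C%C * (a +i* b)%C)) ^+ 2.
  by rewrite exprn_ege1.
rewrite cabs_sqr /=.
rewrite (_ : _ + _ = (1 - s * dl) ^+ 2 * (a ^+ 2 + b ^+ 2)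
   + s * (1 - s * dl) * (2 * (c * a - d * - b)) + s ^+ 2 * (c ^+ 2 + d ^+ 2)); last by ring.
rewrite -zz mulr1.
have : s * (1 - s * dl) * (2 * (c * a - d * - b)) <= 0.
  by apply: mulr_ge0_le0; [apply: mulr_ge0; lra|lra].
have : s * (s * K) < s * dl by rewrite ltr_pM2l.
rewrite /K; nra.
Qed.

End Polydisc.

(** * Complex slices and one-sided derivatives along rays *)

Section Boundary.
Variable R : realType.
Implicit Types (s e d : R).

Lemma hdot_delta m (u : 'cV[R[i]]_m) i : hdot u (delta_mx i 0) = u i 0.
Proof.
rewrite /hdot (bigD1 i) //= big1 ?addr0 => [|k ki].
  by rewrite mxE !eqxx conjc1 mulr1.
by rewrite mxE (negPf ki) andFb mulr0n conjc0 mulr0.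
Qed.

Lemma slice_cdiff n N (f : 'cV[R[i]]_n -> 'cV[R[i]]_N) (z : 'cV[R[i]]_n) b zeta :
  holomorphic_on_polydisc f -> polydisc (zeta *: z) ->
  exists l, cdiff (fun t => hdot (f (t *: z)) b) zeta l.
Proof.
move=> hf pz; have [L HL] := hf _ pz; exists (hdot (L *m z) b) => e e0.
have k1 : 0 < vnorm z * vnorm b + 1.
  by have : 0 <= vnorm z * vnorm b by [rewrite mulr_ge0 // vnorm_ge0]; lra.
have z1 : 0 < vnorm z + 1 by have := vnorm_ge0 z; lra.
have [d [d0 H]] := HL (e / (vnorm z * vnorm b + 1)) ltac:(by rewrite divr_gt0).
exists (d / (vnorm z + 1)); split; first by rewrite divr_gt0.
move=> h; rewrite ltr_pdivlMr // => hd; have h0 := cabs_ge0 h.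
have := H (h *: z); rewrite vnormZ => /(_ _) H1.
have {}H1 : vnorm (f ((zeta + h) *: z) - f (zeta *: z) - L *m (h *: z)) <=
    e / (vnorm z * vnorm b + 1) * (cabs h * vnorm z).
  by rewrite scalerDl; apply: H1; lra.
have -> : hdot (f ((zeta + h) *: z)) b - hdot (f (zeta *: z)) b - hdot (L *m z) b * h =
    hdot (f ((zeta + h) *: z) - f (zeta *: z) - L *m (h *: z)) b.
  by rewrite !hdotBl -scalemxAr hdotZl (mulrC h).
apply: le_trans (cauchy_schwarz _ _) _.
apply: le_trans (ler_wpM2r (vnorm_ge0 _) H1) _.
rewrite [X in X <= _](_ : _ = e * cabs h * (vnorm z * vnorm b / (vnorm z * vnorm b + 1))).
  rewrite ler_piMr ?mulr_ge0 // ?(ltW e0) // ler_pdivrMr //; lra.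
by field; rewrite gt_eqF.
Qed.

Lemma polydiscZ n (z : 'cV[R[i]]_n) c : cl_polydisc z -> cabs c < 1 -> polydisc (c *: z).
Proof.
move=> zc c1 j; rewrite mxE cabsM; have := zc j; have := cabs_ge0 (z j 0).
have := cabs_ge0 c; nra.
Qed.

(** The Schwarz lemma for the function u |-> h(f(u z)), which vanishes at 0 and is bounded by 1
    through [ball_pick_le]. The denominator [X] is cleared in the conclusion, so that the limit at
    the boundary can be taken without dividing. *)
Lemma radial_schwarz n N (f : 'cV[R[i]]_n -> 'cV[R[i]]_N) (z : 'cV[R[i]]_n)
    (w0 : 'cV[R[i]]_N) (t : R) :
  holomorphic_on_polydisc f -> (forall u, polydisc u -> unit_ball (f u)) ->
  cl_polydisc z -> vnorm w0 <= 1 -> 0 <= t -> t < 1 ->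
  let a := f 0 in let w := f (t%:C%C *: z) in
  let X := (1 - hdot w a) * (1 - hdot a w0) in
  is_true (cabs (X - (1 - hdot a a) * (1 - hdot w w0)) <= t * cabs X).
Proof.
move=> hf bf zc w01 t0 t1 a.
have disc0 : polydisc (0 : 'cV[R[i]]_n) by move=> j; rewrite mxE cabs0.
have a1 : vnorm a < 1 by exact: bf.
have aw : 1 - hdot a w0 != 0 by exact: one_sub_hdot_neq0.
pose w u := f (u *: z).
have w1 u : cabs u < 1 -> vnorm (w u) < 1 by move=> u1; apply: bf; exact: polydiscZ.
pose X u := (1 - hdot (w u) a) * (1 - hdot a w0).
have X0 u : cabs u < 1 -> X u != 0.
  by move=> u1; rewrite mulf_neq0 // one_sub_hdot_neq0 ?w1 // ltW.
pose k := (1 - hdot a a) / (1 - hdot a w0).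
(* Written with sums, products and one inverse only, to match [cdiffD], [cdiffM] and [cdiffV]; [HE]
   returns to the quotient form. *)
pose H u := 1 + (- k) * ((1 + -1 * hdot (w u) w0) * (1 + -1 * hdot (w u) a)^-1).
have HE u : cabs u < 1 -> H u = (X u - (1 - hdot a a) * (1 - hdot (w u) w0)) / X u.
  move=> u1; rewrite /H /k !mulN1r /X; field.
  by rewrite aw one_sub_hdot_neq0 ?w1 // ltW.
have HS : forall u, cabs u < 1 -> cabs (H u) <= cabs u.
  apply: schwarz_lemma => [u u1|u u1|].
  - have pu := polydiscZ zc u1.
    have [l1 D1] := slice_cdiff w0 hf pu; have [l2 D2] := slice_cdiff a hf pu.
    eexists; apply: cdiffD; first exact: cdiff_const.
    apply: cdiffM; first exact: cdiff_const.
    apply: cdiffM; first by apply: cdiffD; [exact: cdiff_const|apply: cdiffM D1; exact: cdiff_const].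
    apply: cdiffV; first by apply: cdiffD; [exact: cdiff_const|apply: cdiffM D2; exact: cdiff_const].
    by rewrite mulN1r one_sub_hdot_neq0 ?w1 // ltW.
  - rewrite HE // cabsM cabsV ler_pdivrMr ?cabs_gt0 ?X0 // mul1r.
    by apply: ball_pick_le; rewrite // ltW // w1.
  - rewrite HE ?cabs0 // /X /w scale0r -/a.
    by rewrite (mulrC (1 - hdot a a)) subrr mul0r.
have tt : cabs t%:C%C = t by rewrite cabs_real ger0_norm.
have := HS t%:C%C; rewrite tt => /(_ t1); rewrite HE ?tt // cabsM cabsV.
by rewrite ler_pdivrMr // cabs_gt0 X0 // tt.
Qed.

Lemma ray_quotient n N (g : 'cV[R[i]]_n -> 'cV[R[i]]_N) (p v : 'cV[R[i]]_n)
    (T b : 'cV[R[i]]_N) :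
  (forall e, 0 < e -> exists d, 0 < d /\ forall s, 0 < s < d ->
     vnorm (g (p + s%:C%C *: v) - g p - s%:C%C *: T) <= e * s) ->
  tends0 (fun s => (hdot (g (p + s%:C%C *: v)) b - hdot (g p) b) / s%:C%C) (hdot T b).
Proof.
move=> H e e0; have b1 : 0 < vnorm b + 1 by have := vnorm_ge0 b; lra.
have [d [d0 {}H]] := H (e / (vnorm b + 1)) ltac:(by rewrite divr_gt0).
exists d; split=> // s sd; have s0 : 0 < s by case/andP: sd.
have sC : s%:C%C != 0 :> R[i] by rewrite -cabs_gt0 cabs_real gtr0_norm.
have -> : (hdot (g (p + s%:C%C *: v)) b - hdot (g p) b) / s%:C%C - hdot T b =
   hdot (g (p + s%:C%C *: v) - g p - s%:C%C *: T) b / s%:C%C.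
  by rewrite !hdotBl hdotZl; field.
rewrite cabsM cabsV cabs_real (gtr0_norm s0) ler_pdivrMr //.
apply: le_trans (cauchy_schwarz _ _) _.
apply: le_trans (ler_wpM2r (vnorm_ge0 _) (H s sd)) _.
rewrite [X in X <= _](_ : _ = e * s * (vnorm b / (vnorm b + 1))).
  rewrite ler_piMr ?mulr_ge0 // ?(ltW e0) ?(ltW s0) // ler_pdivrMr //; lra.
by field; rewrite gt_eqF.
Qed.

Lemma holomorphic_ray n N (f : 'cV[R[i]]_n -> 'cV[R[i]]_N) p (v : 'cV[R[i]]_n)
    (L : 'M[R[i]]_(N, n)) b :
  (forall e : R, 0 < e -> exists d : R, 0 < d /\
      forall h : 'cV[R[i]]_n, vnorm h < d ->
        vnorm (f (p + h) - f p - L *m h) <= e * vnorm h) ->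
  tends0 (fun s => (hdot (f (p + s%:C%C *: v)) b - hdot (f p) b) / s%:C%C) (hdot (L *m v) b).
Proof.
move=> HL; apply: ray_quotient => e e0.
have v1 : 0 < vnorm v + 1 by have := vnorm_ge0 v; lra.
have [d [d0 H]] := HL (e / (vnorm v + 1)) ltac:(by rewrite divr_gt0).
exists (d / (vnorm v + 1)); split; first by rewrite divr_gt0.
move=> s /andP[s0]; rewrite ltr_pdivlMr // => sd.
have := H (s%:C%C *: v); rewrite vnormZ cabs_real (gtr0_norm s0) -scalemxAr => /(_ _) H1.
apply: le_trans (H1 _) _; first by nra.
rewrite [X in X <= _](_ : _ = e * s * (vnorm v / (vnorm v + 1))).
  rewrite ler_piMr ?mulr_ge0 // ?(ltW e0) ?(ltW s0) // ler_pdivrMr //; lra.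
by field; rewrite gt_eqF.
Qed.

Lemma real_diffZ n N (Dx Dy : 'I_n -> 'cV[R[i]]_n -> 'cV[R[i]]_N) p s (v : 'cV[R[i]]_n) :
  real_diff Dx Dy p (s%:C%C *: v) = s%:C%C *: real_diff Dx Dy p v.
Proof.
rewrite /real_diff scaler_sumr; apply: eq_bigr => j _; rewrite mxE.
have sr : s%:C%C \is Num.real by rewrite complex_real.
by rewrite ReMl // ImMl // scalerDr !scalerA.
Qed.

Lemma relative_ray n N (S : 'cV[R[i]]_n -> Prop) (g : 'cV[R[i]]_n -> 'cV[R[i]]_N)
    (Dx Dy : 'I_n -> 'cV[R[i]]_n -> 'cV[R[i]]_N) p v b d0 :
  (forall e : R, 0 < e -> exists d : R, 0 < d /\
       forall q, S q -> vnorm (q - p) < d ->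
         vnorm (g q - g p - real_diff Dx Dy p (q - p)) <= e * vnorm (q - p)) ->
  0 < d0 -> (forall s, 0 < s < d0 -> S (p + s%:C%C *: v)) ->
  tends0 (fun s => (hdot (g (p + s%:C%C *: v)) b - hdot (g p) b) / s%:C%C)
    (hdot (real_diff Dx Dy p v) b).
Proof.
move=> HD d00 HS; apply: ray_quotient => e e0.
have v1 : 0 < vnorm v + 1 by have := vnorm_ge0 v; lra.
have [d [dp H]] := HD (e / (vnorm v + 1)) ltac:(by rewrite divr_gt0).
exists (Num.min d0 (d / (vnorm v + 1))); split; first by rewrite lt_min d00 divr_gt0.
move=> s /andP[s0]; rewrite lt_min ltr_pdivlMr // => /andP[sd0 sd].
have := H (p + s%:C%C *: v); rewrite (addrC p) addrK real_diffZ.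
rewrite vnormZ cabs_real (gtr0_norm s0) addrC => /(_ _) H1.
apply: le_trans (H1 _ _) _; first by apply: HS; rewrite s0.
  by nra.
rewrite [X in X <= _](_ : _ = e * s * (vnorm v / (vnorm v + 1))).
  rewrite ler_piMr ?mulr_ge0 // ?(ltW e0) ?(ltW s0) // ler_pdivrMr //; lra.
by field; rewrite gt_eqF.
Qed.

Lemma real_diff_delta n N (Dx Dy : 'I_n -> 'cV[R[i]]_n -> 'cV[R[i]]_N) p j :
  real_diff Dx Dy p (delta_mx j 0) = Dx j p /\
  real_diff Dx Dy p ('i *: delta_mx j 0) = Dy j p.
Proof.
split; rewrite /real_diff (bigD1 j) //= big1 => [|k kj].
- rewrite !mxE !eqxx /= (Creal_ReP _ _) ?real1 // (Creal_ImP _ _) ?real1 //.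
  by rewrite scale1r scale0r !addr0.
- by rewrite !mxE (negPf kj) /= raddf0 raddf0 !scale0r addr0.
- by rewrite !mxE !eqxx /= mulr1 Re_i Im_i scale1r scale0r add0r addr0.
- by rewrite !mxE (negPf kj) /= mulr0 raddf0 raddf0 !scale0r addr0.
Qed.

End Boundary.

(** * Cauchy-Riemann equations up to the boundary *)

Section CauchyRiemann.
Variable R : realType.
Implicit Types (s e d : R).

(** At an interior point the real differential of [g] and the complex derivative of [f] both give
    the derivative along every ray, hence agree. Complex linearity, tested on e_j and i e_j, relates
    the two partial derivatives. *)
Lemma CR_interior n N (f g : 'cV[R[i]]_n -> 'cV[R[i]]_N) alpha z0 rho Dx Dy p j :
  holomorphic_on_polydisc f -> C1alpha_extension_at alpha f z0 rho g Dx Dy ->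
  polydisc p -> vnorm (p - z0) < rho -> Dy j p = 'i *: Dx j p.
Proof.
move=> hf [rho0 [gf [HD _]]] pp pr; have [L HL] := hf p pp.
have ray (v : 'cV[R[i]]_n) b : hdot (real_diff Dx Dy p v) b = hdot (L *m v) b.
  have [d1 [d10 Hd1]] := polydisc_ray v pp.
  have v1 : 0 < vnorm v + 1 by have := vnorm_ge0 v; lra.
  pose d2 := (rho - vnorm (p - z0)) / (vnorm v + 1).
  have d20 : 0 < d2 by rewrite divr_gt0 // subr_gt0.
  pose d := Num.min d1 d2.
  have d0 : 0 < d by rewrite lt_min d10.
  have inS s : 0 < s < d -> polydisc (p + s%:C%C *: v) /\ vnorm (p + s%:C%C *: v - z0) < rho.
    move=> /andP[s0]; rewrite lt_min => /andP[sd1 sd2]; split.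
      by apply: Hd1; rewrite s0.
    move: sd2; rewrite /d2 ltr_pdivlMr // => sd2.
    have -> : p + s%:C%C *: v - z0 = (p - z0) + s%:C%C *: v by rewrite addrAC.
    apply: le_lt_trans (vnormD _ _) _; rewrite vnormZ cabs_real gtr0_norm //.
    by nra.
  apply: tends0_unique (holomorphic_ray v b HL).
  apply: (@tends0_near R (fun s => (hdot (g (p + s%:C%C *: v)) b - hdot (g p) b) / s%:C%C) _ _ d d0).
    by move=> s /inS[h1 h2]; rewrite !gf.
  apply: (@relative_ray R n N (fun z => cl_polydisc z /\ vnorm (z - z0) < rho)) d0 _.
    by apply: HD; split=> // k; apply: ltW; exact: pp.
  by move=> s /inS[h1 h2]; split=> // k; apply: ltW; exact: h1.
apply/matrixP => i k; rewrite ord1 mxE -!hdot_delta.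
have [<- <-] := real_diff_delta Dx Dy p j.
by rewrite !ray -scalemxAr hdotZl.
Qed.

Lemma powR_small (K alpha e V : R) : 0 < alpha -> 0 < e -> 0 <= V ->
  exists d, 0 < d /\ forall s, 0 < s < d -> K * powR (s * V) alpha <= e.
Proof.
(* [K] may be zero or negative, so it is replaced by a positive upper bound. *)
move=> a0 e0 V0; pose K1 := `|K| + 1.
have K10 : 0 < K1 by rewrite /K1; have := normr_ge0 K; lra.
pose x := powR (e / K1) alpha^-1.
have eK : 0 < e / K1 by rewrite divr_gt0.
have x0 : 0 < x by exact: powR_gt0.
have V1 : 0 < V + 1 by lra.
exists (x / (V + 1)); split; first by rewrite divr_gt0.
move=> s /andP[s0]; rewrite ltr_pdivlMr // => sx.
have sV : 0 <= s * V by rewrite mulr_ge0 // ltW.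
have h : powR (s * V) alpha <= e / K1.
  apply: (@le_trans _ _ (powR x alpha)).
    by apply: ge0_ler_powR; rewrite ?nnegrE ?(ltW a0) ?(ltW x0) //; nra.
  by rewrite /x -powRrM mulVf ?gt_eqF // powRr1 // ltW.
apply: (@le_trans _ _ (K1 * (e / K1))); last by rewrite mulrC divfK // gt_eqF.
apply: le_trans (ler_wpM2l (ltW K10) h).
by apply: ler_wpM2r; [exact: powR_ge0|rewrite /K1; have := ler_norm K; lra].
Qed.

(** The interior points (1 - s) z0 tend to z0, and the Hoelder bound carries the Cauchy-Riemann
    equation over to the limit. *)
Lemma CR_boundary n N (f g : 'cV[R[i]]_n -> 'cV[R[i]]_N) alpha z0 rho Dx Dy j :
  0 < alpha -> holomorphic_on_polydisc f -> cl_polydisc z0 ->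
  C1alpha_extension_at alpha f z0 rho g Dx Dy -> Dy j z0 = 'i *: Dx j z0.
Proof.
move=> a0 hf z0c HC; have [rho0 [gf [HD [K HK]]]] := HC.
suff h e : 0 < e -> vnorm (Dy j z0 - 'i *: Dx j z0) <= e.
  apply/eqP; rewrite -subr_eq0; apply/eqP/matrixP => i k; rewrite ord1 [RHS]mxE.
  apply/eqP; rewrite -cabs_eq0 eq_le cabs_ge0 andbT; apply/ler_addgt0Pr => e e0.
  by rewrite add0r; apply: le_trans (cabs_le_vnorm _ _) (h e e0).
move=> e0; have e2 : 0 < e / 2 by lra.
have [d [d0 Hd]] := powR_small K a0 e2 (vnorm_ge0 z0).
have V1 : 0 < vnorm z0 + 1 by have := vnorm_ge0 z0; lra.
pose m := Num.min d (Num.min 1 (rho / (vnorm z0 + 1))).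
have m0 : 0 < m by rewrite !lt_min d0 ltr01 divr_gt0.
have [md m1 mr] : [/\ m <= d, m <= 1 & m <= rho / (vnorm z0 + 1)].
  by rewrite /m !ge_min !lexx !orbT.
pose s := m / 2; have s0 : 0 < s by rewrite /s; lra.
pose p : 'cV[R[i]]_n := (1 - s)%:C%C *: z0.
have zp : z0 - p = s%:C%C *: z0.
  by rewrite /p rcB scalerBl scale1r opprB addrC subrK.
have nzp : vnorm (z0 - p) = s * vnorm z0 by rewrite zp vnormZ cabs_real gtr0_norm.
have pr : vnorm (p - z0) < rho.
  rewrite -vnormN opprB nzp.
  have : s < rho / (vnorm z0 + 1) by rewrite /s; lra.
  by rewrite ltr_pdivlMr //; nra.
have pp : polydisc p.
  by apply: polydiscZ => //; rewrite cabs_real ger0_norm /s; lra.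
have S0 : cl_polydisc z0 /\ vnorm (z0 - z0) < rho.
  by rewrite subrr -(scale0r z0) vnormZ cabs0 mul0r.
have Sp : cl_polydisc p /\ vnorm (p - z0) < rho by split=> // k; apply: ltW; exact: pp.
have [] := HK j z0 p S0 Sp; rewrite nzp => hx hy.
have hs : K * powR (s * vnorm z0) alpha <= e / 2 by apply: Hd; rewrite /s; lra.
have -> : Dy j z0 - 'i *: Dx j z0 = (Dy j z0 - Dy j p) - 'i *: (Dx j z0 - Dx j p).
  by rewrite (CR_interior j hf HC pp pr) scalerBr opprB addrA subrK.
apply: le_trans (vnormD _ _) _; rewrite vnormN vnormZ.
have -> : cabs ('i : R[i]) = 1.
  by rewrite -complexiE cabsE /= expr0n expr1n add0r sqrtr1.
lra.
Qed.

(** Under the Cauchy-Riemann equations (Dx - i Dy) / 2 equals Dx, and the real differential becomes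
    complex linear. *)
Lemma cjacobian_CR n N (Dx Dy : 'I_n -> 'cV[R[i]]_n -> 'cV[R[i]]_N) p :
  (forall j, Dy j p = 'i *: Dx j p) ->
  forall v, real_diff Dx Dy p v = cjacobian Dx Dy p *m v.
Proof.
move=> CR v; apply/matrixP => i k; rewrite ord1 summxE mxE; apply: eq_bigr => j _.
have -> : cjacobian Dx Dy p i j = Dx j p i 0.
  rewrite mxE CR mxE mulrA -expr2 sqrCi mulN1r opprK -mulr2n.
  by rewrite -[_ *+ 2]mulr_natr mulfK ?pnatr_eq0.
by rewrite !mxE CR mxE [in RHS](Crect (v j 0)); ring.
Qed.

End CauchyRiemann.

(** * Derivative at the boundary point *)

Section BoundaryDerivative.
Variable R : realType.
Implicit Types (s e d : R).

Lemma inv_rc s : ((s%:C)^-1 = (s^-1)%:C)%C. Proof. by rewrite fmorphV. Qed.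

Lemma Re_mul_rc (z : R[i]) s : Re (z * s%:C%C) = Re z * s.
Proof. by rewrite RecM /= mulr0 subr0. Qed.

Variables (n N : nat) (f : 'cV[R[i]]_n -> 'cV[R[i]]_N) (z0 : 'cV[R[i]]_n).
Variables (w0 : 'cV[R[i]]_N) (J : 'M[R[i]]_(N, n)).
Hypothesis f_hol : holomorphic_on_polydisc f.
Hypothesis f_ball : forall z, polydisc z -> unit_ball (f z).
Hypothesis z0c : cl_polydisc z0.
Hypothesis w01 : vnorm w0 = 1.
(** Boundary regularity enters this section through one-sided derivatives along rays into the
    polydisc, with w0 as the value at z0. *)
Hypothesis J_ray : forall (v : 'cV[R[i]]_n) b d, 0 < d ->
  (forall s, 0 < s < d -> polydisc (z0 + s%:C%C *: v)) ->
  tends0 (fun s => (hdot (f (z0 + s%:C%C *: v)) b - hdot w0 b) / s%:C%C) (hdot (J *m v) b).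

Lemma w0w0 : hdot w0 w0 = 1. Proof. by rewrite hdot_vnorm w01 expr1n. Qed.

Lemma inward_derivative_le0 v d : 0 < d ->
  (forall s, 0 < s < d -> polydisc (z0 + s%:C%C *: v)) -> Re (hdot (J *m v) w0) <= 0.
Proof.
move=> d0 Hd; have T := tends0N (J_ray w0 d0 Hd).
rewrite -oppr_ge0 -RecN; apply: tends0_Re_ge0 d0 _ T => s sd.
have s0 : 0 < s by case/andP: sd.
rewrite RecN oppr_ge0 inv_rc Re_mul_rc w0w0 pmulr_lle0 ?invr_gt0 // RecD RecN /= subr_le0.
apply: le_trans (ler_norm _) _; apply: le_trans (Re_le_cabs _) _.
apply: le_trans (cauchy_schwarz _ _) _; rewrite w01 mulr1.
by apply: ltW; apply: f_ball; exact: Hd.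
Qed.

(** Replacing v by v - dl z0 makes the direction point strictly inward, which costs only dl times a
    fixed number; dl is then arbitrarily small. *)
Lemma tangential_derivative_le0 (v : 'cV[R[i]]_n) :
  (forall j, cabs (z0 j 0) = 1 -> Re (v j 0 * conjc (z0 j 0)) <= 0) ->
  Re (hdot (J *m v) w0) <= 0.
Proof.
move=> vz; set M := Re (hdot (J *m z0) w0).
have M1 : 0 < `|M| + 1 by have := normr_ge0 M; lra.
apply/ler_addgt0Pr => e e0; rewrite add0r.
have dl0 : 0 < e / (`|M| + 1) by rewrite divr_gt0.
have [d [d0 Hd]] := inward_direction dl0 z0c vz.
have := inward_derivative_le0 d0 Hd.
rewrite mulmxBr hdotBl -scalemxAr hdotZl mulrC RecD RecN Re_mul_rc -/M subr_le0 => h.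
apply: le_trans h _; rewrite mulrC mulrAC ler_pdivrMr // ler_pM2l //.
by have := ler_norm M; lra.
Qed.

(** At t = 1 - s the Schwarz bound reads |X - s Y| <= (1 - s) |X|. Squaring and dividing by s gives
    2 Re(conj(X) Y) >= (2 - s) |X|^2 + s |Y|^2. As s tends to 0, X tends to |D|^2 and Y to (1 -
    |a|^2) <J z0, w0>. *)
Lemma radial_derivative_ge (a := f 0) :
  cabs (1 - hdot w0 a) ^+ 2 <= (1 - vnorm a ^+ 2) * Re (hdot (J *m z0) w0).
Proof.
have disc0 : polydisc (0 : 'cV[R[i]]_n) by move=> j; rewrite mxE cabs0.
have a1 : vnorm a < 1 by exact: f_ball.
have rayE s : z0 + s%:C%C *: (- z0) = (1 - s)%:C%C *: z0.
  by rewrite scalerN rcB scalerBl scale1r.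
have ray s : 0 < s < 1 -> polydisc (z0 + s%:C%C *: (- z0)).
  move=> s1; rewrite rayE; apply: polydiscZ => //; rewrite cabs_real ger0_norm; lra.
set D := 1 - hdot w0 a; set k := 1 - hdot a w0; set A := 1 - hdot a a.
have kD : k = conjc D by rewrite /D conjcB conjc1 hdotC.
have AE : A = (1 - vnorm a ^+ 2)%:C%C by rewrite /A hdot_vnorm rcB.
pose Q b s := (hdot (f (z0 + s%:C%C *: (- z0))) b - hdot w0 b) / s%:C%C.
have TQ b : tends0 (Q b) (- hdot (J *m z0) b).
  by have := J_ray b ltr01 ray; rewrite mulmxN hdotNl.
pose X s := (D - s%:C%C * Q a s) * k; pose Y s := A * (- Q w0 s).
pose psi := hdot (J *m z0) w0.
have TX : tends0 X ((cabs D ^+ 2)%:C%C).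
  rewrite -mul_conjc -kD -[D in X in tends0 _ X]addr0 -oppr0 -[X in D - X](mul0r (- hdot (J *m z0) a)).
  apply: tends0M; last exact: tends0_const.
  apply: tends0D; first exact: tends0_const.
  by apply: tends0N; apply: tends0M; [exact: tends0_id|exact: TQ].
have TY : tends0 Y (A * psi).
  apply: tends0M; first exact: tends0_const.
  by rewrite -[psi]opprK; apply: tends0N; exact: TQ.
pose F s := 2 * (conjc (X s) * Y s) - (2 - s%:C%C) * (X s * conjc (X s)).
have TF : tends0 F (2 * (conjc (cabs D ^+ 2)%:C%C * (A * psi))
    - (2 - 0) * ((cabs D ^+ 2)%:C%C * conjc (cabs D ^+ 2)%:C%C)).
  apply: tends0D.
    apply: tends0M; first exact: tends0_const.
    by apply: tends0M => //; exact: tends0_conj.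
  apply: tends0N; apply: tends0M.
    by apply: tends0D; [exact: tends0_const|apply: tends0N; exact: tends0_id].
  by apply: tends0M => //; exact: tends0_conj.
have F0 s : 0 < s < 1 -> 0 <= Re (F s).
  move=> s1; have s0 : 0 < s by case/andP: s1.
  have sC : s%:C%C != 0 :> R[i] by rewrite -cabs_gt0 cabs_real gtr0_norm.
  have fE b : hdot (f (z0 + s%:C%C *: (- z0))) b = hdot w0 b + s%:C%C * Q b s.
    by rewrite /Q; field.
  have t0 : 0 <= 1 - s by lra.
  have t1 : 1 - s < 1 by lra.
  have := radial_schwarz f_hol f_ball z0c (_ : vnorm w0 <= 1) t0 t1.
  rewrite w01 lexx => /(_ isT) /=; rewrite -/a -rayE !fE w0w0 -/k -/A.
  have -> : (1 - (hdot w0 a + s%:C%C * Q a s)) * k = X s by rewrite /X /D; ring.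
  have -> : A * (1 - (1 + s%:C%C * Q w0 s)) = s%:C%C * Y s by rewrite /Y; ring.
  move=> h.
  have : cabs (X s - s%:C%C * Y s) ^+ 2 <= ((1 - s) * cabs (X s)) ^+ 2.
    by rewrite ler_pXn2r ?nnegrE ?mulr_ge0 ?cabs_ge0.
  rewrite exprMn !cabs_sqr /F; case: (X s) => x1 x2; case: (Y s) => y1 y2 /= hh.
  rewrite -(pmulr_rge0 _ s0).
  have := sqr_ge0 (s * y1); have := sqr_ge0 (s * y2); nra.
have := tends0_Re_ge0 ltr01 F0 TF.
have D0 : D != 0.
  have : 1 - hdot a w0 != 0 by apply: one_sub_hdot_neq0; rewrite ?w01.
  by rewrite -/k kD conjc_eq0.
have Dp : 0 < cabs D ^+ 2 by rewrite exprn_gt0 // cabs_gt0.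
rewrite /psi AE conjc_real; case: (hdot (J *m z0) w0) => p1 p2 /=; set d := cabs D ^+ 2 in Dp *.
set K := 1 - vnorm a ^+ 2 => h.
rewrite -(ler_pM2l Dp); nra.
Qed.

End BoundaryDerivative.

(** * Assembly of the boundary identity, coordinate by coordinate *)

Theorem theorem1p2 (R : realType) (n N : nat) (alpha : R)
  (f : 'cV[R[i]]_n -> 'cV[R[i]]_N) (z0 : 'cV[R[i]]_n) (r : nat) :
  (1 <= n)%N -> (1 <= N)%N -> 0 < alpha -> alpha < 1 ->
  holomorphic_on_polydisc f ->
  (forall z, polydisc z -> unit_ball (f z)) ->
  (1 <= r)%N -> (r <= n)%N ->
  (forall j : 'I_n, (j < r)%N -> cabs (z0 j 0) = 1) ->
  (forall j : 'I_n, (r <= j)%N -> cabs (z0 j 0) < 1) ->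
  forall (rho : R) (g : 'cV[R[i]]_n -> 'cV[R[i]]_N)
         (Dx Dy : 'I_n -> 'cV[R[i]]_n -> 'cV[R[i]]_N),
  C1alpha_extension_at alpha f z0 rho g Dx Dy ->
  forall w0 : 'cV[R[i]]_N, g z0 = w0 -> vnorm w0 = 1 ->
  let a := f 0 in
  let lambda : R :=
    cabs (1 - ((adjoint a) *m w0) 0 0) ^+ 2 / (1 - vnorm a ^+ 2) in
  exists gamma : 'I_n -> R,
    (forall j : 'I_n, (j < r)%N -> 0 <= gamma j) /\
    1 <= \sum_(j < n | (j < r)%N) gamma j /\
    0 < lambda /\
    adjoint (cjacobian Dx Dy z0) *m w0 =
      (real_complex R lambda) *:
        (diag_mx (\row_(j < n) (if (j < r)%N then real_complex R (gamma j) else 0))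
          *m z0).
Proof.
move=> _ _ a0 _ f_hol f_ball _ _ zlt zge rho g Dx Dy HC w0 gz0 w01 a lambda.
have z0c : cl_polydisc z0.
  by move=> j; have [/zlt ->|/zge/ltW] := ltnP j r.
set J := cjacobian Dx Dy z0.
have JE v : real_diff Dx Dy z0 v = J *m v.
  by apply: cjacobian_CR => j; exact: CR_boundary a0 f_hol z0c HC.
have J_ray (v : 'cV[R[i]]_n) b (d : R) : 0 < d ->
    (forall s : R, 0 < s < d -> polydisc (z0 + s%:C%C *: v)) ->
    tends0 (fun s => (hdot (f (z0 + s%:C%C *: v)) b - hdot w0 b) / s%:C%C) (hdot (J *m v) b).
  case: HC => rho0 [gf [HD _]] d0 Hd.
  have v1 : 0 < vnorm v + 1 by have := vnorm_ge0 v; lra.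
  pose d' := Num.min d (rho / (vnorm v + 1)).
  have d'0 : 0 < d' by rewrite lt_min d0 divr_gt0.
  have near s : 0 < s < d' -> polydisc (z0 + s%:C%C *: v) /\
      vnorm (z0 + s%:C%C *: v - z0) < rho.
    move=> /andP[s0]; rewrite lt_min ltr_pdivlMr // => /andP[sd sr].
    split; first by apply: Hd; rewrite s0.
    by rewrite addrC addKr vnormZ cabs_real gtr0_norm //; nra.
  rewrite -JE -gz0.
  apply: (@tends0_near R (fun s => (hdot (g (z0 + s%:C%C *: v)) b - hdot (g z0) b) / s%:C%C) _ _ d' d'0).
    by move=> s /near[h1 h2]; rewrite gf.
  apply: (@relative_ray R n N (fun z => cl_polydisc z /\ vnorm (z - z0) < rho)) d'0 _.
    by apply: HD; split=> //; rewrite subrr -(scale0r z0) vnormZ cabs0 mul0r.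
  by move=> s /near[h1 h2]; split=> // j; apply: ltW; exact: h1.
(* This is <J e_j, w0>, the conjugate of the j-th entry of the vector to be computed. *)
pose psi j := \sum_i J i j * conjc (w0 i 0).
have hJ v : hdot (J *m v) w0 = \sum_j v j 0 * psi j.
  rewrite /hdot; under eq_bigr do rewrite mxE mulr_suml.
  rewrite exchange_big /=; apply: eq_bigr => j _; rewrite /psi mulr_sumr.
  by apply: eq_bigr => i _; rewrite mulrAC mulrC mulrA.
have hJd (c : R[i]) j : hdot (J *m (c *: delta_mx j 0)) w0 = c * psi j.
  rewrite hJ (bigD1 j) //= big1 ?addr0 => [|k kj]; first by rewrite !mxE !eqxx mulr1.
  by rewrite !mxE (negPf kj) mulr0 mul0r.
have tang (c : R[i]) j : (cabs (z0 j 0) = 1 -> Re (c * conjc (z0 j 0)) <= 0) -> Re (c * psi j) <= 0.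
  move=> hc; rewrite -hJd; apply: (tangential_derivative_le0 f_ball z0c w01 J_ray) => k.
  have [->|kj] := eqVneq k j; first by rewrite !mxE !eqxx mulr1.
  by rewrite !mxE (negPf kj) mulr0 mul0r.
(* For j >= r every multiple of e_j is an admissible direction; conj(psi_j) e_j yields |psi_j|^2 <=
   0. *)
have psi0 (j : 'I_n) : (r <= j)%N -> psi j = 0.
  move=> /zge zj; have h : Re (conjc (psi j) * psi j) <= 0.
    by apply: tang => z1; move: zj; rewrite z1 ltxx.
  apply/eqP; rewrite -cabs_eq0 -sqrf_eq0 eq_le sqr_ge0 andbT cabs_sqr.
  by move: h; case: (psi j) => x y /=; nra.
(* The inward direction -z0_j e_j gives the sign of the real part; the tangential directions i z0_j
   e_j and its opposite kill the imaginary part. *)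
have psir (j : 'I_n) : (j < r)%N -> 0 <= Re (z0 j 0 * psi j) /\ Im (z0 j 0 * psi j) = 0.
  move=> /zlt zj; have zz := cabs_sqr (z0 j 0); rewrite zj in zz.
  have h1 := @tang (- z0 j 0) j; have h2 := @tang ('i%C * z0 j 0) j.
  have h3 := @tang (- ('i%C * z0 j 0)) j.
  move: zz h1 h2 h3; rewrite zj; case: (z0 j 0) => x y; case: (psi j) => u v /= zz h1 h2 h3.
  have {}h1 := h1 (fun _ => ltac:(nra)).
  have {}h2 := h2 (fun _ => ltac:(nra)).
  have {}h3 := h3 (fun _ => ltac:(nra)).
  by split; nra.
have aw : ((adjoint a) *m w0) 0 0 = hdot w0 a.
  by rewrite mxE; apply: eq_bigr => i _; rewrite !mxE mulrC.
have disc0 : polydisc (0 : 'cV[R[i]]_n) by move=> j; rewrite mxE cabs0.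
have a1 : vnorm a < 1 by exact: f_ball.
have K0 : 0 < 1 - vnorm a ^+ 2 by rewrite subr_gt0 expr_lt1 // vnorm_ge0.
have l0 : 0 < lambda.
  rewrite /lambda divr_gt0 // exprn_gt0 // cabs_gt0 aw -hdotC.
  rewrite -conjc_eq0 conjcB conjcK conjc1.
  by apply: one_sub_hdot_neq0; rewrite ?w01.
(* Dividing by lambda normalises the sum: the z0_j psi_j add up to <J z0, w0>, whose real part is at
   least lambda by [radial_derivative_ge]. *)
exists (fun j => Re (z0 j 0 * psi j) / lambda); split.
  by move=> j /psir[h _]; rewrite divr_ge0 // ltW.
split.
  rewrite -mulr_suml ler_pdivlMr // mul1r.
  have -> : \sum_(j < n | (j < r)%N) Re (z0 j 0 * psi j) = Re (hdot (J *m z0) w0).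
    rewrite hJ Re_sum [RHS](bigID (fun j : 'I_n => (j < r)%N)) /= [X in _ = _ + X]big1 ?addr0 //.
    by move=> j; rewrite -leqNgt => /psi0 ->; rewrite mulr0.
  rewrite /lambda aw ler_pdivrMr // mulrC.
  exact: (radial_derivative_ge f_hol f_ball z0c w01 J_ray).
split=> //; apply/matrixP => j k; rewrite ord1.
have -> : (adjoint J *m w0) j 0 = conjc (psi j).
  rewrite mxE /psi (big_morph conjc (@conjcD R) (conjc0 _)); apply: eq_bigr => i _.
  by rewrite [adjoint _ _ _]mxE [map_mx _ _ _ _]mxE conjcM conjcK.
rewrite mxE mul_diag_mx !mxE; case: ltnP => jr; last by rewrite psi0 // conjc0 mul0r mulr0.
have [_ im0] := psir j jr.
rewrite mulrA -rcM mulrCA mulfV ?gt_eqF // mulr1.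
(* Since z0_j psi_j is real it equals its conjugate, and |z0_j| = 1 then turns its product with z0_j
   into conj(psi_j). *)
have -> : (Re (z0 j 0 * psi j))%:C%C = conjc (z0 j 0 * psi j).
  by move: im0; case: (z0 j 0 * psi j) => x y /= ->; rewrite oppr0.
by rewrite conjcM mulrAC (mulrC (conjc (z0 j 0)) (z0 j 0)) mul_conjc zlt // expr1n mul1r.
Qed.
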